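(* Let $f:\mathbb{R}^K\to\mathbb{R}$ be a concave function, strictly concave in a neighborhood of its maximizer $\mathbf{x}^*$ on $\mathbb{R}^K$, globally Lipschitz with constant $L$, and with bounded second and third derivatives. Let $\mathbf{x}(n)$ be the vectors generated by the asynchronous distributed Kiefer–Wolfowitz algorithm described in the context, with step sizes satisfying $\epsilon(n),\gamma(n)\in(0,1)$, $\sum_n \gamma^2(n)/\epsilon^2(n)<\infty$, $\sum_n\gamma(n)\epsilon^2(n)<\infty$, and $\gamma(n)/\epsilon^2(n)$ bounded. Then $$\mathbf{x}(n)\to\mathbf{x}^*\quad\text{almost surely as } n\to\infty .$$
   Context: There are $K$ agents ($K\ge 1$). Let $\tau\ge 2$ be an integer and $p_k\in\{0,\dots,\tau-1\}$ for $k=1,\dots,K$. For $k=1,\dots,K$ and $n\ge 0$ let $T_k(n)=n\tau+p_k-\tau\,1\{p_k=\tau-1\}$, so that $T_k(n)+1\in\{n\tau,\dots,n\tau+\tau-1\}$. Let $x_k(m)$ be the value of the variable of agent $k$ at step $m$, and let $\mathbf{x}(m)\in\mathbb{R}^K$ be the vector with components $x_k(m)$. Agent $k$ experiments at times $T_k(n)+1$ and updates at times $T_k(n)+2$, $n\ge 0$; at other times his variable keeps its value. Thus the agents experiment and update every $\tau$ steps and may be out of phase with one another. Algorithm: for $k=1,\dots,K$, $n\ge0$ and $m=T_k(n)$, $$x_k(m+1)=x_k(m)+a_k(n)\epsilon(n)\ \text{(experiment)},\qquad x_k(m+2)=x_k(m)+g_k(n)\gamma(n)\ \text{(update)},$$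 where $$g_k(n)=\frac{f(\mathbf{x}(m+1))-f(\mathbf{x}(m))+\eta_k(n)}{x_k(m+1)-x_k(m)}.$$ Here the $a_k(n)$ are independent random variables with $P(a_k(n)=-1)=P(a_k(n)=1)=0.5$, and the $\eta_k(n)$ (observation noise) are independent, zero-mean, bounded random variables. An example of step sizes given for these conditions is $\gamma(n)=n^{-0.75}$, $\epsilon(n)=n^{-0.2}$.
   Formalization: Two step-size conditions are added: sum of γ(n) is infinite (otherwise the iterates may move only a finite distance and never reach x* ) and ε(n)→0 (forced by the conclusion, since each experiment moves a coordinate by ε(n), but not implied by the listed conditions). *)

(* Defs.v *)
From HB Require Import structures.
From mathcomp Require Import all_boot all_order all_algebra.
From mathcomp Require Import all_classical all_reals all_analysis.

Set Implicit Arguments.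
Unset Strict Implicit.
Unset Printing Implicit Defensive.

Import Order.TTheory GRing.Theory Num.Theory.
Import numFieldNormedType.Exports.

Local Open Scope classical_set_scope.
Local Open Scope ring_scope.

(* The library norm on 'rV[R]_K is the maximum norm. *)
Definition euclidean_norm (R : realType) (K : nat) (v : 'rV[R]_K) : R :=
  Num.sqrt (\sum_i v 0 i ^+ 2).

Definition euclidean_lipschitz (R : realType) (K : nat) (L : R)
    (f : 'rV[R]_K -> R) : Prop :=
  forall x y, `|f x - f y| <= L * euclidean_norm (x - y).

Definition concave_function (R : realType) (K : nat) (f : 'rV[R]_K -> R) : Prop :=
  convex_function [set: 'rV[R]_K] (fun x => - f x).

Definition strictly_concave_on (R : realType) (K : nat) (U : set 'rV[R]_K)
    (f : 'rV[R]_K -> R) : Prop :=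
  forall x y, U x -> U y -> x != y -> forall t : R, 0 < t -> t < 1 ->
    t * f x + (1 - t) * f y < f (t *: x + (1 - t) *: y).

Definition partial (R : realType) (K : nat) (i : 'I_K) (f : 'rV[R]_K -> R) :
    'rV[R]_K -> R :=
  fun x => 'D_(delta_mx 0 i) f x.

(* A real function on R^K is three times differentiable iff it and its partial
   derivatives of orders 1 and 2 are (Frechet) differentiable; its second and
   third derivatives are bounded iff the partial derivatives of these orders
   are. *)
Definition bounded_derivatives23 (R : realType) (K : nat)
    (f : 'rV[R]_K -> R) : Prop :=
  [/\ forall x, differentiable f x,
      forall i x, differentiable (partial i f) x,
      forall i j x, differentiable (partial j (partial i f)) x,
      exists C : R, forall i j x, `|partial j (partial i f) x| <= C &
      exists C : R, forall i j l x,
        `|partial l (partial j (partial i f)) x| <= C].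

Definition mutually_independent (d : measure_display) (T : measurableType d)
    (R : realType) (P : probability T R) (I : eqType) (X : I -> {RV P >-> R}) :
    Prop :=
  forall (s : seq I) (B : I -> set R), uniq s -> (forall i, measurable (B i)) ->
    P (\big[setI/setT]_(i <- s) (X i @^-1` B i)) =
    (\prod_(i <- s) P (X i @^-1` B i))%E.

(* The random signs and the observation noises, as one family. *)
Definition join_families (A B : Type) (C : Type) (a b : A -> B -> C)
    (i : A * B + A * B) : C :=
  match i with
  | inl kn => a kn.1 kn.2
  | inr kn => b kn.1 kn.2
  end.

(* The time T_k(n).  It equals -1 when n = 0 and p_k = tau - 1, so the time
   steps are integers, starting from -1. *)
Definition kw_time (K tau : nat) (p : 'I_K -> 'I_tau) (k : 'I_K) (n : nat) :
    int :=
  n%:Z * tau%:Z + (p k)%:Z - (if p k == tau.-1 :> nat then tau%:Z else 0).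

Section KieferWolfowitz.
Variables (R : realType) (T : Type) (K tau : nat) (p : 'I_K -> 'I_tau).
Variables (f : 'rV[R]_K -> R) (gamma eps : nat -> R).
Variables (a eta : 'I_K -> nat -> T -> R) (x : int -> T -> 'rV[R]_K).

Definition kw_gradient (k : 'I_K) (n : nat) (w : T) : R :=
  let m := kw_time p k n in
  (f (x (m + 1) w) - f (x m w) + eta k n w) / (x (m + 1) w 0 k - x m w 0 k).

Record kw_iterates (x0 : 'rV[R]_K) : Prop := KWIterates {
  kw_init : forall w, x (-1) w = x0;
  kw_experiment : forall k n w, let m := kw_time p k n in
    x (m + 1) w 0 k = x m w 0 k + a k n w * eps n;
  kw_update : forall k n w, let m := kw_time p k n in
    x (m + 2) w 0 k = x m w 0 k + kw_gradient k n w * gamma n;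
  kw_keep : forall k (m : int) w, -1 <= m ->
    (forall n, m + 1 != kw_time p k n + 1 /\ m + 1 != kw_time p k n + 2) ->
    x (m + 1) w 0 k = x m w 0 k
}.

End KieferWolfowitz.

(* Main.v *)
Require Import Defs.
From HB Require Import structures.
From mathcomp Require Import all_boot all_order all_algebra.
From mathcomp Require Import all_classical all_reals all_analysis.
From mathcomp Require Import measurable_realfun.
From mathcomp Require Import zify ring lra.

Set Implicit Arguments.
Unset Strict Implicit.
Unset Printing Implicit Defensive.

Import Order.TTheory GRing.Theory Num.Theory.
Import numFieldNormedType.Exports.

Local Open Scope classical_set_scope.
Local Open Scope ring_scope.

(** The estimate of agent [k] compares [f] at two consecutive times, so it is
    polluted by the moves of all other agents, which are as large as its own.
    What rescues it is that everything in the estimate except the wanted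
    derivative is multiplied by the agent's own random sign.  Let [u] be the
    state right after the experiment with the move of agent [k] undone, [a] the
    sign, [F] the preceding value of [f] and [e] the step along axis [k].  Then,
    as [a] is 1 or -1,
      (f (u + a e) - F + eta) / (a eps)
        = (f (u + e) - f (u - e)) / (2 eps)
          + a ((f (u + e) + f (u - e)) / 2 - F + eta) / eps,
    which is [gradient_decomposition].  The first term does not involve the
    sign, and the factor of [a] in the second term is independent of [a].

    The second terms, weighted by [gamma], are therefore martingale
    differences, for the sigma-algebras generated by all variables but the
    present and future signs of agent [k].  These sigma-algebras contain the
    future signs of the other agents, so the order in which the agents act
    does not matter and each agent can be treated alone.  The terms are bounded
    by a multiple of gamma / eps, which is square summable; hence their partial
    sums converge almost surely ([sign_transform_cvg], by the second moment
    bound, optional stopping and the Chebyshev inequality).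

    The first term is the partial derivative at a point whose distance from the
    vector [y n] of the values of the agents before their [n]-th experiments is
    O(eps + gamma / eps) ([increment_bounded], [slot_dist]).  As the gradient
    is Lipschitz, it equals the partial derivative at [y n] up to a bias that
    tends to 0 ([central_quotient_bias]).  Altogether
      y (n + 1) = y n + gamma n (grad f (y n) + b n) + (M (n + 1) - M n)
    with [b] tending to 0 and [M] convergent, along almost every path.

    What remains is deterministic ([noisy_ascent_cvg]).  Away from the
    maximizer, concavity makes the gradient point towards it, by an amount that
    is bounded below outside every ball ([concave_gap], [concave_gradient]).
    The divergence of the sum of [gamma] brings the path into the ball, and
    [gamma] tending to 0 keeps it in a slightly larger one. *)

(** * Calculus in several variables *)

Section Calculus.
Variables (R : realType) (K : nat).
Implicit Types (f : 'rV[R]_K -> R) (x v : 'rV[R]_K).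

Lemma coord_le_norm x i : `|x 0 i| <= `|x|.
Proof.
rewrite [leRHS]/Num.norm /= mx_normrE; apply/bigmax_geP; right.
by exists (0, i).
Qed.

Lemma norm_le_coord x (c : R) : 0 <= c -> (forall i, `|x 0 i| <= c) -> `|x| <= c.
Proof.
move=> c0 xc; rewrite [leLHS]/Num.norm /= mx_normrE; apply/bigmax_leP; split=> //.
by case=> a i _; rewrite ord1.
Qed.

Lemma derive_partial f x v : differentiable f x ->
  'D_v f x = \sum_i v 0 i * partial i f x.
Proof.
move=> df; rewrite deriveE// [in LHS](row_sum_delta v) linear_sum.
by apply: eq_bigr => i _; rewrite linearZ /partial deriveE.
Qed.

Lemma mean_value f x v : (forall y, differentiable f y) ->
  exists2 t, t \in `[0, 1] & f (x + v) - f x = 'D_v f (x + t *: v).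
Proof.
move=> df.
have dphi (t : R) : is_derive t 1 (fun t => f (t *: v + x)) ('D_v f (t *: v + x)).
  have E : (fun h => h^-1 *: (f ((h + t) *: v + x) - f (t *: v + x))) =
           (fun h => h^-1 *: (f (h *: v + (t *: v + x)) - f (t *: v + x))).
    by apply/funext => h; rewrite scalerDl addrA.
  have dv := diff_derivable (df (t *: v + x)) : derivable f (t *: v + x) v.
  split.
    rewrite /derivable /=.
    under eq_fun do rewrite [_ *: (1 : R)]mulr1.
    by rewrite E.
  rewrite /derive /=.
  under eq_fun do rewrite [_ *: (1 : R)]mulr1.
  by rewrite E.
have [|t t01] := @MVT_segment R (fun t => f (t *: v + x))
    (fun t => 'D_v f (t *: v + x)) 0 1 ler01 (fun t _ => dphi t).
  apply: continuous_subspaceT => t; apply: differentiable_continuous.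
  by apply/derivable1_diffP; case: (dphi t).
rewrite subr0 mulr1 scale1r scale0r add0r => E.
by exists t => //; rewrite (addrC x v) E (addrC x).
Qed.

Lemma partial_bounded_lipschitz f (C : R) :
    (forall y, differentiable f y) -> (forall i y, `|partial i f y| <= C) ->
  forall x y, `|f x - f y| <= C * K%:R * `|x - y|.
Proof.
move=> df fC x y.
have [t _] := mean_value y (x - y) df; rewrite subrKC => ->.
rewrite derive_partial// (le_trans (ler_norm_sum _ _ _))//.
apply: (@le_trans _ _ (\sum_(i < K) `|x - y| * C)).
  by apply: ler_sum => i _; rewrite normrM ler_pM// coord_le_norm.
by rewrite sumr_const card_ord -mulr_natr; lra.
Qed.

End Calculus.

(** * Concave functions *)

Section Concave.
Variables (R : realType) (K : nat) (f : 'rV[R]_K -> R).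
Hypothesis f_concave : concave_function f.
Implicit Types (x y v : 'rV[R]_K) (t : R).

Lemma concave_segment x y t : 0 <= t <= 1 ->
  (1 - t) * f x + t * f y <= f (x + t *: (y - x)).
Proof.
move=> t01.
have [t0 t1] := andP t01.
have := f_concave (Itv01 t0 t1) (mem_set (I : setT y)) (mem_set (I : setT x)).
rewrite convRE /conv /= => h.
have -> : x + t *: (y - x) = t *: y + (1 - t) *: x.
  by rewrite scalerBr scalerBl scale1r addrC -addrA (addrC (- _)).
have : - f (t *: y + (1 - t) *: x) <= t * - f y + (1 - t) * - f x by exact: h.
lra.
Qed.

Lemma concave_gradient x y : differentiable f x -> f y - f x <= 'D_(y - x) f x.
Proof.
move=> df; have dv := diff_derivable df : derivable f x (y - x).
rewrite /derive cvg_at_rightE; last exact: dv.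
apply: limr_ge; first by apply: cvgP; apply: cvg_dnbhs_at_right; exact: dv.
near=> h.
have h0 : 0 < h by near: h; exact: nbhs_right_gt.
have h1 : h < 1 by near: h; exact: nbhs_right_lt.
have h01 : 0 <= h <= 1 by rewrite !ltW.
have /= := concave_segment x y h01; rewrite (addrC x) => le.
rewrite -[leRHS]/(h^-1 * _) -ler_pdivrMl ?invr_gt0// invrK /=.
by move: le; lra.
Unshelve. all: by end_near. Qed.

(** By [concave_gradient] the partial derivative lies between the backward and
    the forward unit difference, so a Lipschitz bound passes to it without any
    limit. *)
Lemma concave_partial_bound x (C : R) : differentiable f x ->
    (forall i, `|f (x + delta_mx 0 i) - f x| <= C) ->
    (forall i, `|f (x - delta_mx 0 i) - f x| <= C) ->
  forall i, `|partial i f x| <= C.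
Proof.
move=> df fp fm i; rewrite ler_norml; apply/andP; split.
- have := concave_gradient (x + delta_mx 0 i) df; rewrite (addrAC x) subrr add0r.
  have := fp i; rewrite ler_norml => /andP[+ _] /=; rewrite /partial.
  lra.
- have := concave_gradient (x - delta_mx 0 i) df; rewrite (addrAC x) subrr add0r.
  rewrite deriveE// linearN -deriveE//.
  by have := fm i; rewrite ler_norml => /andP[+ _] /=; rewrite /partial; lra.
Qed.

Variable xstar : 'rV[R]_K.
Hypothesis xstar_max : forall x, f x <= f xstar.

(** Were there a second maximizer, [f] would be constant on the segment to it,
    against strict concavity on the part of the segment inside [U]. *)
Lemma strict_maximizer (U : set 'rV[R]_K) :
    nbhs xstar U -> strictly_concave_on U f ->
  forall x, x != xstar -> f x < f xstar.
Proof.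
move=> nU fU x xx; rewrite lt_neqAle xstar_max andbT; apply/negP => /eqP fx.
have segmax t : 0 <= t <= 1 -> f (xstar + t *: (x - xstar)) = f xstar.
  move=> t01; apply/eqP; rewrite eq_le xstar_max /=.
  by have := concave_segment xstar x t01; rewrite fx; lra.
have [t /= t0 Ut] : exists2 t : R, 0 < t <= 1 & U (xstar + t *: (x - xstar)).
  have : (fun t : R => xstar + t *: (x - xstar)) @ (0 : R)^'+ --> xstar.
    apply: cvg_at_right_filter; rewrite -[X in _ --> X]addr0 -(scale0r (x - xstar)).
    by apply: cvgD; [exact: cvg_cst | apply: cvgZr_tmp; exact: cvg_id].
  move=> /(_ _ nU) nt.
  near ((0 : R)^'+) => t; exists t; last by near: t; exact: nt.
  by apply/andP; split; [|apply: ltW]; near: t;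
    [exact: nbhs_right_gt|exact: nbhs_right_lt].
have ne : xstar != xstar + t *: (x - xstar).
  rewrite eq_sym -subr_eq0 (addrAC xstar) subrr add0r scaler_eq0 subr_eq0.
  by rewrite negb_or xx gt_eqF//; case/andP: t0.
have /(_ 2^-1) := fU _ _ (nbhs_singleton nU) Ut ne.
rewrite segmax; last by case/andP: t0 => /ltW -> ->.
have -> : 2^-1 *: xstar + (1 - 2^-1) *: (xstar + t *: (x - xstar))
    = xstar + (2^-1 * t) *: (x - xstar) :> 'rV[R]_K.
  have -> : 1 - 2^-1 = 2^-1 :> R by lra.
  rewrite scalerDr addrA -scalerDl scalerA.
  have -> : 2^-1 + 2^-1 = 1 :> R by lra.
  by rewrite scale1r.
rewrite segmax; last by case/andP: t0 => t0 t1; apply/andP; split; lra.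
by move=> /(_ ltac:(lra) ltac:(lra)); lra.
Unshelve. all: by end_near. Qed.

(** On the compact sphere of radius [r] the gap is at least some positive
    constant; along a ray from the maximizer, concavity makes it grow at least
    linearly from there on. *)
Lemma concave_gap (r : R) : 0 < r -> (forall x, differentiable f x) ->
    (forall x, x != xstar -> f x < f xstar) ->
  exists2 c, 0 < c & forall x, r <= `|x - xstar| ->
    c * `|x - xstar| <= f xstar - f x.
Proof.
move=> r0 df fmax.
pose S := [set y : 'rV[R]_K | `|y - xstar| = r].
have proj x : r <= `|x - xstar| -> S (xstar + (r / `|x - xstar|) *: (x - xstar)).
  move=> rx; rewrite /S /= (addrAC xstar) subrr add0r normrZ ger0_norm ?divfK ?gt_eqF//.
    exact: lt_le_trans rx.
  by rewrite divr_ge0// ltW.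
have [[y0 Sy0]|S0] := pselect (S !=set0); last first.
  exists 1 => // x rx; exfalso; apply: S0.
  by eexists; exact: proj rx.
have cS : compact S.
  apply: bounded_closed_compact.
    exists (`|xstar| + r); split; first by rewrite num_real.
    move=> M rM y Sy; apply: le_trans (ltW rM).
    have <- : `|y - xstar| = r := Sy.
    by rewrite -{1}(subrK xstar y) addrC ler_normD.
  have cn : continuous (fun y : 'rV[R]_K => `|y - xstar|).
    move=> y; have h : (fun z : 'rV[R]_K => z - xstar) z @[z --> y] --> y - xstar.
      by apply: continuousB; [exact: cvg_id|exact: cst_continuous].
    exact: (cvg_norm h).
  exact: (closed_comp (D := [set r]) (fun y _ => cn y) (@closed_eq R r)).
have [||y yS ymax] := @EVT_max_rV R K f S _ cS.
- by exists y0.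
- by apply: continuous_subspaceT => y; exact: differentiable_continuous.
have {yS}Sy : S y by rewrite inE in yS.
have fy : f y < f xstar.
  apply: fmax; apply/eqP => yx; move: Sy; rewrite /S /= yx subrr normr0.
  by move=> r0'; move: r0; rewrite -r0' ltxx.
exists ((f xstar - f y) / r); first by rewrite divr_gt0// subr_gt0.
move=> x rx; have x0 := lt_le_trans r0 rx.
have t01 : 0 <= r / `|x - xstar| <= 1.
  by rewrite divr_ge0 ?(ltW r0)//= ler_pdivrMr// mul1r.
have := ymax _ (mem_set (proj _ rx)).
have := concave_segment xstar x t01; set t := r / _ => h1 h2.
rewrite mulrAC ler_pdivrMr//.
have -> : r = t * `|x - xstar| by rewrite /t divfK// gt_eqF.
rewrite mulrA ler_pM2r//; lra.
Qed.

End Concave.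

(** * Gradient ascent with vanishing perturbations *)

Section Ascent.
Variable R : realType.

(** Since the sum of [gamma] diverges, [u] cannot decrease by [gamma n * delta]
    for ever, so it gets below [B]; from then on both cases keep it there. *)
Lemma descent_below (u gamma : nat -> R) (delta B : R) (n0 : nat) :
    0 < delta -> (forall n, 0 <= u n) -> (forall n, 0 <= gamma n) ->
    (forall A, exists n, A < \sum_(0 <= i < n) gamma i) ->
    (forall n, (n0 <= n)%N ->
      u n.+1 <= u n - gamma n * delta \/ u n.+1 <= B) ->
  exists n1, forall n, (n1 <= n)%N -> u n <= B.
Proof.
move=> d0 u0 g0 gdiv step.
have [[n1 [n01 un1]]|nob] :=
    pselect (exists n1, (n0 <= n1)%N /\ u n1 <= B).
  exists n1; elim=> [|n ih]; first by rewrite leqn0 => /eqP <-.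
  rewrite leq_eqVlt => /predU1P[<-//|]; rewrite ltnS => n1n.
  have [h|//] := step n (leq_trans n01 n1n).
  rewrite (le_trans h)// (le_trans _ (ih n1n))// gerBl.
  by rewrite mulr_ge0// ltW.
exfalso.
have dec n : u (n0 + n)%N <= u n0 - delta * \sum_(n0 <= i < n0 + n) gamma i.
  elim: n => [|n ih]; first by rewrite addn0 big_geq// mulr0 subr0.
  rewrite addnS big_nat_recr ?leq_addr//=.
  have [|h|h] := step (n0 + n)%N; first by rewrite leq_addr.
    by move: h ih; lra.
  by exfalso; apply: nob; exists (n0 + n).+1; split => //; rewrite leqW// leq_addr.
have [n] := gdiv (\sum_(0 <= i < n0) gamma i + u n0 / delta).
have [nn0|n0n] := leqP n n0.
  rewrite (big_cat_nat (leq0n n) nn0)//= => h.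
  have : 0 <= u n0 / delta by rewrite divr_ge0// ltW.
  have : 0 <= \sum_(n <= i < n0) gamma i by exact: sumr_ge0.
  by lra.
rewrite (big_cat_nat (leq0n n0) (ltnW n0n))//= ltrD2l ltr_pdivrMr// => h.
have := dec (n - n0)%N; rewrite subnKC ?(ltnW n0n)// => h'.
have := u0 n; lra.
Qed.

Variables (K : nat) (xstar : 'rV[R]_K) (G : 'rV[R]_K -> 'I_K -> R) (C : R).
Hypothesis G_bounded : forall v i, `|G v i| <= C.
Hypothesis G_inward : forall r, 0 < r -> exists2 c, 0 < c &
  forall v, r <= `|v - xstar| ->
    c * `|v - xstar| <= \sum_i (xstar - v) 0 i * G v i.
Variable gamma : nat -> R.
Hypothesis gamma_ge0 : forall n, 0 <= gamma n.
Hypothesis gamma_cvg0 : gamma n @[n --> \oo] --> 0.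
Hypothesis gamma_div : forall A, exists n, A < \sum_(0 <= i < n) gamma i.

(** The squared distance to [xstar] is the Lyapunov function.  At distance at
    least [r] the inward drift, of order [gamma n], dominates both the
    perturbation and the second order term, of order [gamma n ^+ 2]; at
    distance less than [r] one step is too short to leave the ball of radius
    [2 * r]. *)
Lemma perturbed_ascent_cvg (v : nat -> 'rV[R]_K) (b : nat -> 'I_K -> R) :
    (forall i, b n i @[n --> \oo] --> 0) ->
    (forall n i, v n.+1 0 i = v n 0 i + gamma n * (G (v n) i + b n i)) ->
  v n @[n --> \oo] --> xstar.
Proof.
move=> b0 vS.
pose V n := \sum_i (v n 0 i - xstar 0 i) ^+ 2.
have C0 : 0 <= `|C| by [].
suff main r : 0 < r -> \forall n \near \oo, V n <= K%:R * (2 * r) ^+ 2.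
  apply/cvgrPdist_le => e e0.
  pose k : R := K%:R + 1.
  have k0 : 0 < k by rewrite ltr_wpDl.
  have r0 : 0 < e / (2 * k) by rewrite divr_gt0// mulr_gt0.
  near=> n; rewrite distrC.
  apply: norm_le_coord; first exact: ltW.
  move=> i; rewrite !mxE.
  have : V n <= K%:R * (2 * (e / (2 * k))) ^+ 2 by near: n; exact: main.
  have -> : 2 * (e / (2 * k)) = e / k by field; rewrite gt_eqF.
  move=> Vn; rewrite -ler_sqr ?nnegrE ?(ltW e0)// real_normK ?num_real//.
  apply: (@le_trans _ _ (V n)).
    by rewrite /V (bigD1 i)//= lerDl sumr_ge0// => j _; exact: sqr_ge0.
  apply: (le_trans Vn); rewrite exprMn exprVn mulrA ler_pdivrMr ?exprn_gt0//.
  rewrite mulrC ler_wpM2l ?sqr_ge0// /k.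
  have K0 : 0 <= K%:R :> R by [].
  by nra.
move=> r0; have [c c0 inw] := G_inward r0.
pose kap : R := K%:R + 1.
have k0 : 0 < kap by rewrite ltr_wpDl.
pose C1 := `|C| + 1.
have C10 : 0 < C1 by rewrite ltr_wpDl.
(* be makes the perturbation cost at most half of the inward drift; ga makes
   the second order term cost at most a quarter of it, and bounds a step by r. *)
pose be := Num.min 1 (c / (2 * kap)).
have be0 : 0 < be by rewrite lt_min ltr01 divr_gt0// mulr_gt0.
pose ga := Num.min (r / C1) (c * r / (2 * (kap * C1 ^+ 2))).
have ga0 : 0 < ga.
  by rewrite lt_min !divr_gt0// ?mulr_gt0// ?exprn_gt0// mulr_gt0.
have [n0 _ Hn0] : \forall n \near \oo, gamma n <= ga /\ forall i, `|b n i| <= be.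
  near=> n; split.
    near: n; have /cvgrPdist_le/(_ _ ga0) := gamma_cvg0.
    by apply: filterS => n; rewrite sub0r normrN ger0_norm.
  near: n; apply: filter_forall => i.
  have /cvgrPdist_le/(_ _ be0) := b0 i.
  by apply: filterS => n; rewrite sub0r normrN.
have [|||||n1 Hn1] := @descent_below V gamma (c * r / 2) (K%:R * (2 * r) ^+ 2) n0.
- by rewrite divr_gt0// mulr_gt0.
- by move=> n; apply: sumr_ge0 => i _; exact: sqr_ge0.
- by [].
- by [].
- move=> n /Hn0[gn bn].
  pose D i := v n 0 i - xstar 0 i; pose g i := G (v n) i + b n i.
  have gb i : `|g i| <= C1.
    rewrite (le_trans (ler_normD _ _))// lerD//.
      exact: le_trans (G_bounded _ _) (ler_norm _).
    by rewrite (le_trans (bn i))// ge_min lexx.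
  have Vn1 : V n.+1 = \sum_i (D i + gamma n * g i) ^+ 2.
    by apply: eq_bigr => i _; rewrite vS /D /g; congr (_ ^+ 2); ring.
  have ga1 : gamma n * C1 <= r.
    by rewrite -ler_pdivlMr// (le_trans gn)// ge_min lexx.
  have ga2 : gamma n * (K%:R * C1 ^+ 2) <= c * r / 2.
    have : gamma n <= c * r / (2 * (kap * C1 ^+ 2)).
      by rewrite (le_trans gn)// ge_min lexx orbT.
    rewrite ler_pdivlMr ?mulr_gt0 ?exprn_gt0// => h.
    have : gamma n * (K%:R * C1 ^+ 2) <= gamma n * (kap * C1 ^+ 2).
      by rewrite ler_wpM2l// ler_wpM2r ?sqr_ge0// lerDl.
    by move: h; lra.
  have [rN|Nr] := leP r `|v n - xstar|; last first.
    right; rewrite Vn1 mulr_natl -[in leRHS](card_ord K) -sumr_const.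
    apply: ler_sum => i _.
    rewrite -[leLHS]real_normK ?num_real// ler_sqr ?nnegrE//; last first.
      by rewrite mulr_ge0// ltW.
    rewrite (le_trans (ler_normD _ _))// mulr_natl mulr2n lerD//.
      by rewrite ltW// (le_lt_trans _ Nr)// (le_trans _ (coord_le_norm _ i))// !mxE.
    rewrite normrM ger0_norm// (le_trans _ ga1)// ler_wpM2l//.
  left; set N := `|_| in rN; have N0 : 0 <= N := normr_ge0 _.
  have DN i : `|D i| <= N by have := coord_le_norm (v n - xstar) i; rewrite !mxE.
  have e1 : V n.+1 = V n + 2 * gamma n * (\sum_i D i * g i)
      + gamma n ^+ 2 * \sum_i g i ^+ 2.
    rewrite Vn1 /V !mulr_sumr -!big_split /=; apply: eq_bigr => i _; rewrite /D; ring.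
  have s2 : \sum_i g i ^+ 2 <= K%:R * C1 ^+ 2.
    rewrite mulr_natl -[in leRHS](card_ord K) -sumr_const.
    apply: ler_sum => i _; rewrite -[leLHS]real_normK ?num_real//.
    by rewrite ler_sqr ?nnegrE ?(ltW C10).
  have s1 : \sum_i D i * g i <= - (c * N) + N * c / 2.
    rewrite (eq_bigr (fun i => D i * G (v n) i + D i * b n i)); last first.
      by move=> i _; rewrite /g mulrDr.
    rewrite big_split /= lerD//.
      have := inw _ rN; rewrite lerNr -sumrN => /le_trans; apply.
      by apply: ler_sum => i _; rewrite !mxE /D; lra.
    apply: (@le_trans _ _ (\sum_(i < K) N * (c / (2 * kap)))).
      apply: ler_sum => i _; rewrite (le_trans (ler_norm _))// normrM ler_pM//.
      by rewrite (le_trans (bn i))// ge_min lexx orbT.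
    rewrite sumr_const card_ord -[leLHS]mulr_natr -!mulrA ler_wpM2l// ler_pM2l//.
    by rewrite invfM -mulrA ger_pMr ?invr_gt0// mulrC ler_pdivrMr// mul1r lerDl.
  rewrite e1; have gn0 := gamma_ge0 n.
  have t1 : 2 * gamma n * (\sum_i D i * g i) <= 2 * gamma n * (- (c * N) + N * c / 2).
    by rewrite ler_wpM2l// mulr_ge0.
  have t2 : gamma n ^+ 2 * \sum_i g i ^+ 2 <= gamma n * (c * r / 2).
    rewrite expr2 -mulrA ler_wpM2l// (le_trans _ ga2)// ler_wpM2l//.
  have t3 : gamma n * (c * r) <= gamma n * (c * N).
    by rewrite ler_wpM2l// ler_pM2l.
  by move: t1 t2 t3; lra.
by exists n1 => // n; exact: Hn1.
Unshelve. all: by end_near. Qed.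

(** The shifted iterates [y n - (M n - lim M)] have no noise left; the shift
    tends to 0, so by the Lipschitz bound it only adds a vanishing perturbation
    to the drift. *)
Lemma noisy_ascent_cvg (D : R) (y : nat -> 'rV[R]_K) (b M : nat -> 'I_K -> R) :
    (forall u v i, `|G u i - G v i| <= D * `|u - v|) ->
    (forall i, b n i @[n --> \oo] --> 0) -> (forall i, cvgn (M ^~ i)) ->
    (forall n i, y n.+1 0 i =
       y n 0 i + gamma n * (G (y n) i + b n i) + (M n.+1 i - M n i)) ->
  y n @[n --> \oo] --> xstar.
Proof.
move=> G_lip b0 cM yS.
pose rest n : 'rV[R]_K := \row_i (M n i - limn (M ^~ i)).
have rest0 : `|rest n| @[n --> \oo] --> 0.
  apply/cvgrPdist_le => e e0; near=> n; rewrite sub0r normrN normr_id.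
  apply: norm_le_coord => [|i]; first exact: ltW.
  move: i; near: n; apply: filter_forall => i.
  have /cvgrPdist_le/(_ _ e0) := cM i.
  by apply: filterS => n; rewrite mxE distrC.
have vcvg : (y n - rest n) @[n --> \oo] --> xstar.
  apply: (@perturbed_ascent_cvg _ (fun n i => b n i + (G (y n) i - G (y n - rest n) i))).
    move=> i; rewrite -[X in _ --> X]addr0; apply: cvgD; first exact: b0.
    apply/norm_cvg0P; apply: (@squeeze_cvgr _ _ _ _ (fun=> 0) (fun n => D * `|rest n|)).
    - near=> n; rewrite normr_ge0 /= (le_trans (G_lip _ _ _))//.
      by rewrite opprB addrC subrK.
    - exact: cvg_cst.
    - by rewrite -(mulr0 D); apply: cvgMr.
  move=> n i; rewrite !mxE yS; ring.
have -> : y = (fun n => (y n - rest n) + rest n) by apply/funext => n; rewrite subrK.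
rewrite -[X in _ --> X]addr0; apply: cvgD => //.
exact/norm_cvg0P.
Unshelve. all: by end_near. Qed.

End Ascent.

(** * Convergence of transforms of balanced signs *)

Section SubSigmaAlgebra.
Variables (d : measure_display) (T : measurableType d) (R : realType).

Lemma measurable_fun_g_sigma_sub (G H : set (set T)) (f : T -> R) :
    (forall A, <<s G >> A -> <<s H >> A) ->
    measurable_fun [set: g_sigma_algebraType G] f ->
  measurable_fun [set: g_sigma_algebraType H] f.
Proof. by move=> GH mf mT B mB; apply: GH; exact: mf. Qed.

Lemma measurable_fun_g_sigma (G : set (set T)) (f : T -> R) :
    (forall A, <<s G >> A -> measurable A) ->
    measurable_fun [set: g_sigma_algebraType G] f -> measurable_fun setT f.
Proof. by move=> GT mf mT B mB; apply: GT; exact: mf. Qed.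

End SubSigmaAlgebra.

Section BalancedTransform.
Variables (d : measure_display) (T : measurableType d) (R : realType).
Variable P : probability T R.

Lemma bounded_integrable (f : T -> R) (C : R) : measurable_fun setT f ->
  (forall w, `|f w| <= C) -> P.-integrable setT (EFin \o f).
Proof.
move=> mf fC; apply: measurable_bounded_integrable => //.
  exact: fin_num_fun_lty.
exists C; split; first by rewrite num_real.
by move=> M CM w _; exact: le_trans (fC w) (ltW CM).
Qed.

(** The functions [\1_U * Y] and [\1_V * Y] have the same law, because [U] and
    [V] split every event of [G] evenly; hence they have the same mean. *)
Lemma balanced_sign_integral (G : set (set T)) (U V : set T) (Y : T -> R) (C : R) :
    (forall A, <<s G >> A -> measurable A) -> measurable U -> measurable V ->
    (forall A, <<s G >> A -> P (A `&` U) = P (A `&` V)) ->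
    measurable_fun [set: g_sigma_algebraType G] Y -> (forall w, `|Y w| <= C) ->
  \int[P]_w ((\1_U w - \1_V w) * Y w) = 0.
Proof.
move=> GT mU mV bal mY YC.
have mYT : measurable_fun setT Y by exact: measurable_fun_g_sigma mY.
have mI W : measurable W -> measurable_fun setT (fun w => \1_W w * Y w).
  by move=> mW; apply: measurable_funM => //; exact: measurable_indic.
have bI W w : `|\1_W w * Y w| <= C.
  rewrite normrM indicE; case: (w \in W) => /=.
    by rewrite normr1 mul1r.
  by rewrite normr0 mul0r (le_trans _ (YC w)).
have iI W : measurable W -> P.-integrable setT (EFin \o (fun w => \1_W w * Y w)).
  by move=> mW; apply: bounded_integrable; [exact: mI|exact: bI].
under eq_Rintegral do rewrite mulrBl.
rewrite RintegralB//; [|exact: iI|exact: iI].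
apply/eqP; rewrite subr_eq0; apply/eqP; congr fine.
have law W (mW : measurable W) :
    (\int[P]_w (\1_W w * Y w)%:E =
     \int[pushforward P (fun w => \1_W w * Y w)%R]_y y%:E)%E.
  rewrite (integral_pushforward (mI W mW) (f := EFin))//.
  exact: iI.
rewrite (law U mU) (law V mV).
apply: eq_measure_integral; [exact: mI|exact: mI|move=> ? ? B mB _].
have split_law W : measurable W ->
    P ((fun w => \1_W w * Y w) @^-1` B) =
    (P ((Y @^-1` B) `&` W) + P ((if 0%R \in B then setT else set0) `&` ~` W))%E.
  move=> mW; rewrite -measureU.
  - congr (P _); apply/seteqP; split => w /=; rewrite indicE.
      have [Ww|nWw] := pselect (W w).
        by rewrite mem_set// mul1r; left.
      by rewrite memNset//= mul0r => B0; right; rewrite mem_set.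
    move=> [[BY Ww]|[+ nWw]]; first by rewrite mem_set// mul1r.
    by rewrite (memNset nWw) mul0r; case: ifPn => // /set_mem.
  - by apply: measurableI => //; rewrite -[X in measurable X]setTI; exact: mYT.
  - by apply: measurableI; [case: ifP|exact: measurableC].
  - by apply/seteqP; split => w //= [[_ ?] [_]].
rewrite -[LHS]/(P ((fun w => \1_U w * Y w) @^-1` B)).
rewrite -[RHS]/(P ((fun w => \1_V w * Y w) @^-1` B)).
rewrite (split_law U mU) (split_law V mV); congr (_ + _)%E.
  by apply: bal; rewrite -[X in <<s G >> X]setTI; exact: mY.
case: ifPn => _; last by rewrite !set0I.
rewrite !setTI !probability_setC//; congr (_ - _)%E.
by rewrite -[U]setTI -[V]setTI; apply: bal; exact: (@measurableT _ (g_sigma_algebraType G)).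
Qed.

Variables (G : nat -> set (set T)) (U V : nat -> set T).
Hypothesis G_measurable : forall n A, <<s G n >> A -> measurable A.
Hypothesis G_nondecreasing : forall n A, <<s G n >> A -> <<s G n.+1 >> A.
Hypothesis U_adapted : forall n, <<s G n.+1 >> (U n).
Hypothesis V_adapted : forall n, <<s G n.+1 >> (V n).
Hypothesis balanced : forall n A, <<s G n >> A ->
  P (A `&` U n) = P (A `&` V n).

(** A random sign given by the events where it is 1 and -1; being 0 elsewhere,
    it is bounded by 1 on the whole space and not just almost surely. *)
Definition balanced_sign n (w : T) : R := \1_(U n) w - \1_(V n) w.

Definition sign_transform (H : nat -> T -> R) n (w : T) : R :=
  \sum_(0 <= i < n) balanced_sign i w * H i w.

Lemma balanced_sign_le1 n w : `|balanced_sign n w| <= 1.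
Proof.
rewrite /balanced_sign !indicE; case: (_ \in U n); case: (_ \in V n) => /=;
by rewrite ?subrr ?subr0 ?sub0r ?normrN ?normr1 ?normr0.
Qed.

Lemma sign_transformS (H : nat -> T -> R) n w :
  sign_transform H n.+1 w = sign_transform H n w + balanced_sign n w * H n w.
Proof. by rewrite /sign_transform big_nat_recr. Qed.

Lemma sign_transform_measurable (H : nat -> T -> R) :
    (forall n, measurable_fun [set: g_sigma_algebraType (G n)] (H n)) ->
  forall n, measurable_fun [set: g_sigma_algebraType (G n)] (sign_transform H n).
Proof.
move=> mH; elim=> [|n ih].
  rewrite /sign_transform; under eq_fun do rewrite big_geq//.
  exact: measurable_cst.
have -> : sign_transform H n.+1 =
    (fun w => sign_transform H n w + balanced_sign n w * H n w).
  by apply/funext => w; exact: sign_transformS.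
have up f := @measurable_fun_g_sigma_sub _ _ R (G n) (G n.+1) f (@G_nondecreasing n).
apply: measurable_funD; first exact: up.
apply: measurable_funM; last exact: up.
by apply: measurable_funB; apply: measurable_indic;
  [exact: U_adapted|exact: V_adapted].
Qed.

(** Martingale differences are orthogonal: the cross term is the integral of a
    balanced sign times a function that is measurable for the past. *)
Lemma sign_transform_second_moment (H : nat -> T -> R) (c : nat -> R) :
    (forall n, measurable_fun [set: g_sigma_algebraType (G n)] (H n)) ->
    (forall n w, `|H n w| <= c n) ->
  forall n, \int[P]_w (sign_transform H n w ^+ 2) <= \sum_(0 <= i < n) c i ^+ 2.
Proof.
move=> mH Hc.
have mM := sign_transform_measurable mH.
have c0 i : 0 <= c i by exact: le_trans (Hc i point).
have sHc i w : `|balanced_sign i w * H i w| <= c i.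
  by rewrite normrM -[leRHS]mul1r ler_pM// balanced_sign_le1.
have bM n w : `|sign_transform H n w| <= \sum_(0 <= i < n) c i.
  by rewrite (le_trans (ler_norm_sum _ _ _))//; exact: ler_sum.
have mMT n := measurable_fun_g_sigma (@G_measurable n) (mM n).
have msT n : measurable_fun setT (balanced_sign n).
  by apply: measurable_funB; apply: measurable_indic;
      apply: (@G_measurable n.+1); [exact: U_adapted|exact: V_adapted].
have bM2 n w : `|sign_transform H n w ^+ 2| <= (\sum_(0 <= i < n) c i) ^+ 2.
  by rewrite normrX ler_sqr ?nnegrE// sumr_ge0.
have iM2 n : P.-integrable setT (EFin \o (fun w => sign_transform H n w ^+ 2)).
  by apply: bounded_integrable; [exact: measurable_funX|exact: bM2].
elim=> [|n ih].
  rewrite big_geq// /sign_transform.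
  under eq_Rintegral do rewrite big_geq// expr0n/=.
  by rewrite Rintegral_cst// mul0r.
rewrite big_nat_recr//=.
pose Y w := 2 * (H n w * sign_transform H n w).
have bY w : `|Y w| <= 2 * (c n * \sum_(0 <= i < n) c i).
  by rewrite !normrM ger0_norm// ler_pM2l// ler_pM.
have mY : measurable_fun [set: g_sigma_algebraType (G n)] Y.
  by apply: measurable_funM => //; exact: measurable_funM.
have iY : P.-integrable setT (EFin \o (fun w => balanced_sign n w * Y w)).
  apply: (@bounded_integrable _ (2 * (c n * \sum_(0 <= i < n) c i))).
    by apply: measurable_funM => //; exact: measurable_fun_g_sigma (@G_measurable n) mY.
  move=> w; rewrite normrM -[leRHS]mul1r ler_pM//; exact: balanced_sign_le1.
have ic : P.-integrable setT (EFin \o (fun=> c n ^+ 2) : T -> _).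
  by apply: (@bounded_integrable _ `|c n ^+ 2|) => //.
have E0 : \int[P]_w (balanced_sign n w * Y w) = 0.
  exact: (balanced_sign_integral (@G_measurable n) (G_measurable (@U_adapted n))
    (G_measurable (@V_adapted n)) (@balanced n) mY bY).
apply: (@le_trans _ _ (\int[P]_w ((sign_transform H n w ^+ 2 + c n ^+ 2)
    + balanced_sign n w * Y w))).
  apply: le_Rintegral => //.
    apply: (@integrableD _ _ _ P setT measurableT
      (EFin \o (fun w => sign_transform H n w ^+ 2 + c n ^+ 2)) _ _ iY).
    exact: (@integrableD _ _ _ P setT measurableT _ _ (iM2 n) ic).
  move=> w _; rewrite sign_transformS.
  have : (balanced_sign n w * H n w) ^+ 2 <= c n ^+ 2.
    by rewrite -[leLHS]real_normK ?num_real// ler_sqr ?nnegrE//.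
  rewrite /Y; lra.
rewrite RintegralD//; last first.
  exact: (@integrableD _ _ _ P setT measurableT _ _ (iM2 n) ic).
rewrite E0 addr0 RintegralD// Rintegral_cst//.
rewrite [X in _ * X](_ : _ = 1); last first.
  by rewrite -[RHS]/(fine 1%E); congr fine; exact: probability_setT.
rewrite mulr1 lerD2r.
exact: ih.
Qed.


Section Convergence.
Variables (H : nat -> T -> R) (c : nat -> R).
Hypothesis mH : forall n, measurable_fun [set: g_sigma_algebraType (G n)] (H n).
Hypothesis Hc : forall n w, `|H n w| <= c n.

Definition confined (lambda : R) (n m : nat) : set T :=
  [set w | forall j, (n <= j <= m)%N ->
    `|sign_transform H j w - sign_transform H n w| < lambda].

Lemma g_sigma_le n m : (n <= m)%N -> forall A, <<s G n >> A -> <<s G m >> A.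
Proof.
move=> nm; rewrite -(subnKC nm); elim: (m - n)%N => [|k ih] A GA.
  by rewrite addn0.
by rewrite addnS; apply: G_nondecreasing; exact: ih.
Qed.

Lemma confined_measurable lambda n m : <<s G m >> (confined lambda n m).
Proof.
pose FT := g_sigma_algebraType (G m).
have mM j : (j <= m)%N -> measurable_fun [set: FT] (sign_transform H j).
  move=> jm; apply: (measurable_fun_g_sigma_sub (@g_sigma_le _ _ jm)).
  exact: sign_transform_measurable.
have -> : confined lambda n m = \bigcap_(j in [set j | (n <= j <= m)%N])
    [set w | `|sign_transform H j w - sign_transform H n w| < lambda].
  by apply/seteqP; split => w /= h j hj; exact: h.
apply: (@bigcap_measurableType _ FT) => j /= /andP[nj jm].
have mD : measurable_fun [set: FT]
    (fun w => sign_transform H j w - sign_transform H n w).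
  by apply: measurable_funB; apply: mM => //; exact: leq_trans jm.
have -> : [set w | `|sign_transform H j w - sign_transform H n w| < lambda] =
    setT `&` (fun w => sign_transform H j w - sign_transform H n w)
      @^-1` `]- lambda, lambda[.
  by rewrite setTI; apply/seteqP; split => w /=; rewrite in_itv /= ltr_norml.
exact: mD.
Qed.

(** Optional stopping: switching the transform off once it has left the
    [lambda]-neighbourhood of its value at time [n] gives another transform
    with the same bounds, which remains outside from then on.  The Chebyshev
    inequality at the single time [m] therefore controls the whole range from
    [n] to [m]. *)
Lemma maximal_inequality lambda n m : 0 < lambda -> (n <= m)%N ->
  (P (~` confined lambda n m) <= ((\sum_(n <= i < m) c i ^+ 2) / lambda ^+ 2)%:E)%E.
Proof.
move=> l0 nm.
pose H' i w := if (n <= i)%N then \1_(confined lambda n i) w * H i w else 0.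
pose c' i := if (n <= i)%N then c i else 0.
have c0 i : 0 <= c i by exact: le_trans (Hc i point).
have mH' i : measurable_fun [set: g_sigma_algebraType (G i)] (H' i).
  have -> : H' i = if (n <= i)%N then (fun w => \1_(confined lambda n i) w * H i w)
      else (fun=> 0) by apply/funext => w; rewrite /H'; case: ifP.
  case: ifP => _; last exact: measurable_cst.
  by apply: measurable_funM => //; apply: measurable_indic; exact: confined_measurable.
have Hc' i w : `|H' i w| <= c' i.
  rewrite /H' /c'; case: ifP => _; last by rewrite normr0.
  rewrite normrM indicE; case: (_ \in _) => /=; first by rewrite normr1 mul1r.
  by rewrite normr0 mul0r.
have stopped w k :
    (confined lambda n (n + k) w -> sign_transform H' (n + k) w =
       sign_transform H (n + k) w - sign_transform H n w) /\
    (~ confined lambda n (n + k) w -> lambda <= `|sign_transform H' (n + k) w|).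
  elim: k => [|k [ih1 ih2]].
    rewrite addn0.
    have -> : sign_transform H' n w = 0.
      rewrite /sign_transform big_nat big1// => i /andP[_ ni].
      by rewrite /H' leqNgt ni mulr0.
    split; first by rewrite subrr.
    case=> j /andP[nj jn]; have -> : j = n by apply/eqP; rewrite eqn_leq jn.
    by rewrite subrr normr0.
  rewrite addnS !sign_transformS.
  have -> : H' (n + k)%N w = (w \in confined lambda n (n + k))%:R * H (n + k)%N w.
    by rewrite /H' leq_addr indicE.
  have [wk|nwk] := pselect (confined lambda n (n + k) w).
    rewrite mem_set// mul1r (ih1 wk) addrAC; split => // nw.
    rewrite leNgt; apply/negP => lt; apply: nw => j /andP[nj].
    rewrite leq_eqVlt => /predU1P[->|]; last by rewrite ltnS => jk; apply: wk; rewrite nj.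
    by rewrite sign_transformS.
  rewrite memNset//= mul0r mulr0 addr0; split; last by move=> _; exact: ih2.
  move=> w1; exfalso; apply: nwk => j /andP[nj jk]; apply: w1.
  by rewrite nj (leq_trans jk).
have l20 : 0 < lambda ^+ 2 by rewrite exprn_gt0.
pose X := sign_transform H' m; pose A := ~` confined lambda n m.
have mA : measurable A.
  by apply: measurableC; apply: (@G_measurable m); exact: confined_measurable.
have mX : measurable_fun setT X.
  apply: (measurable_fun_g_sigma (@G_measurable m)).
  exact: (sign_transform_measurable mH').
have bX w : `|X w| <= \sum_(0 <= i < m) c' i.
  rewrite (le_trans (ler_norm_sum _ _ _))//; apply: ler_sum => i _.
  by rewrite normrM -[leRHS]mul1r ler_pM// balanced_sign_le1.
have iX2 : P.-integrable setT (EFin \o (fun w => X w ^+ 2)).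
  apply: (@bounded_integrable _ ((\sum_(0 <= i < m) c' i) ^+ 2)).
    exact: measurable_funX.
  move=> w; rewrite normrX ler_sqr ?nnegrE// sumr_ge0// => i _.
  by rewrite /c'; case: ifP.
have PA : P A \is a fin_num by exact: fin_num_measure.
rewrite -/A -[leLHS]fineK// lee_fin ler_pdivlMr// mulrC.
have iA : P.-integrable setT (EFin \o (\1_A : T -> R)) by exact: integrable_indic.
have -> : fine (P A) = \int[P]_w (\1_A w).
  by rewrite /Rintegral integral_indic// setIT.
rewrite -RintegralZl//.
have := sign_transform_second_moment mH' Hc' m.
have -> : \sum_(0 <= i < m) c' i ^+ 2 = \sum_(n <= i < m) c i ^+ 2.
  rewrite (big_cat_nat (leq0n n) nm)//= big_nat big1 ?add0r.
    by apply: eq_big_nat => i /andP[ni _]; rewrite /c' ni.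
  by move=> i /andP[_ ni]; rewrite /c' leqNgt ni expr0n.
apply: le_trans; apply: le_Rintegral => //.
  apply: (@bounded_integrable _ (lambda ^+ 2)) => [|w].
    by apply: measurable_funM => //; exact: measurable_indic.
  rewrite normrM (ger0_norm (ltW l20)) ger_pMr// indicE.
  by case: (_ \in _); rewrite ?normr0 ?normr1.
move=> w _; rewrite indicE; case: (boolP (w \in A)) => [|_]; last by rewrite mulr0 sqr_ge0.
rewrite inE mulr1 => nw; have [_] := stopped w (m - n)%N; rewrite subnKC// => /(_ nw) h.
by rewrite -[leRHS]real_normK ?num_real// ler_sqr ?nnegrE// ltW.
Qed.

(** Almost sure Cauchy property: by the maximal inequality the probability of
    moving by [lambda] at some time after [n] is at most the tail of the sum of
    the [c i ^+ 2], divided by [lambda ^+ 2]. *)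
Lemma sign_transform_cvg (B : R) :
    (forall n, \sum_(0 <= i < n) c i ^+ 2 <= B) ->
  {ae P, forall w, cvgn (sign_transform H ^~ w)}.
Proof.
move=> SB; pose S n := \sum_(0 <= i < n) c i ^+ 2.
have ndS : {homo S : n m / (n <= m)%N >-> n <= m}.
  move=> n m nm; rewrite /S [leRHS](big_cat_nat (leq0n n) nm)//= lerDl.
  by apply: sumr_ge0 => i _; exact: sqr_ge0.
have cS : cvgn S.
  by apply: nondecreasing_is_cvgn => //; exists B => _ [n _ <-]; exact: SB.
pose N l := \bigcap_n \bigcup_m ~` confined l n m.
have mW l n m : measurable (confined l n m).
  by apply: (@G_measurable m); exact: confined_measurable.
have mU l n : measurable (\bigcup_m ~` confined l n m).
  by apply: bigcup_measurable => m _; exact: measurableC.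
have PU l n : 0 < l -> (P (\bigcup_m ~` confined l n m) <= ((limn S - S n) / l ^+ 2)%:E)%E.
  move=> l0.
  have cv : P (~` confined l n m) @[m --> \oo] --> P (\bigcup_m ~` confined l n m).
    apply: nondecreasing_cvg_mu => //; first by move=> m; exact: measurableC.
    move=> m m' mm'; apply/subsetPset => w /= nw ww; apply: nw => j /andP[nj jm].
    by apply: ww; rewrite nj (leq_trans jm).
  rewrite -(cvg_lim _ cv)//; apply: lime_le; first exact: cvgP cv.
  exists n => // m /= nm; rewrite (le_trans (maximal_inequality l0 nm))// lee_fin.
  rewrite ler_pM2r ?invr_gt0 ?exprn_gt0// lerBrDl.
  have <- : S m = S n + \sum_(n <= i < m) c i ^+ 2 by rewrite /S -big_cat_nat.
  exact: nondecreasing_cvgn_le.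
have N0 l : 0 < l -> P (N l) = 0%E.
  move=> l0; apply/eqP; rewrite eq_le measure_ge0 andbT; apply/lee_addgt0Pr => e e0.
  rewrite add0e; have l20 : 0 < l ^+ 2 by rewrite exprn_gt0.
  have [n _ /(_ n (leqnn n)) /= hn] : \forall n \near \oo, `|limn S - S n| <= e * l ^+ 2.
    by move/cvgrPdist_le : cS; apply; rewrite mulr_gt0.
  apply: (@le_trans _ _ (P (\bigcup_m ~` confined l n m))).
    apply: le_measure; rewrite ?inE//.
      by apply: bigcapT_measurable.
    by move=> w; exact.
  rewrite (le_trans (PU l n l0))// lee_fin ler_pdivrMr//.
  exact: le_trans (ler_norm _) hn.
have : forall q : nat, \forall w \ae P, ~ N q.+1%:R^-1 w.
  move=> q; exists (N q.+1%:R^-1); split => //.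
  - by apply: bigcapT_measurable.
  - exact: N0.
  - by move=> w /contrapT.
move/ae_foralln; apply: filterS => w nN.
apply/cauchy_cvgP; apply: cauchy_exP => e e0.
have [q qe] : exists q : nat, q.+1%:R^-1 < e.
  exists (Num.truncn e^-1); rewrite invf_plt ?posrE//.
  exact: truncnS_gt.
have /existsNP[n /not_implyP[_ hn]] := nN q.
exists (sign_transform H n w); exists n => // m /= nm.
have : confined q.+1%:R^-1 n m w by apply: contrapT => h; apply: hn; exists m.
by move=> /(_ m); rewrite nm leqnn => /(_ isT); rewrite /ball /= distrC => /lt_trans; apply.
Qed.

End Convergence.

End BalancedTransform.

(** * Cylinder sigma-algebras of an independent family *)

Lemma big_setIP (T : Type) (I : eqType) (s : seq I) (F : I -> set T) w :
  (\big[setI/setT]_(j <- s) F j) w <-> forall j, j \in s -> F j w.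
Proof.
elim: s => [|i s ih]; first by rewrite big_nil.
rewrite big_cons; split => [[Fi /ih h] j|h].
  by rewrite inE => /predU1P[->//|]; exact: h.
split; first by apply: h; rewrite mem_head.
by apply/ih => j js; apply: h; rewrite inE js orbT.
Qed.

Section Cylinders.
Variables (d : measure_display) (T : measurableType d) (R : realType).
Variables (P : probability T R) (I : eqType) (X : I -> {RV P >-> R}).
Implicit Types (J : set I) (A : set T) (B : set R).

Definition cylinders J : set (set T) :=
  [set A | exists (s : seq I) (B : I -> set R),
    [/\ uniq s, forall j, j \in s -> J j, forall j, measurable (B j) &
        A = \big[setI/setT]_(j <- s) X j @^-1` B j]].

Lemma cylinders_measurable J A : <<s cylinders J >> A -> measurable A.
Proof.
move=> /(_ measurable); apply; split; first exact: sigma_algebra_measurable.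
move=> _ [s [B [_ _ mB ->]]].
apply: bigsetI_measurable => j _; rewrite -[X in measurable X]setTI.
exact: measurable_funP.
Qed.

Lemma cylinders_sub J J' : J `<=` J' ->
  forall A, <<s cylinders J >> A -> <<s cylinders J' >> A.
Proof.
move=> JJ'; apply: sub_smallest2r; first exact: smallest_sigma_algebra.
move=> _ [s [B [us sJ mB ->]]].
by exists s, B; split => // j /sJ; exact: JJ'.
Qed.

Lemma cylinders_measurable_fun J j : J j ->
  measurable_fun [set: g_sigma_algebraType (cylinders J)] (X j).
Proof.
move=> Jj _ B mB; rewrite setTI; apply: sub_sigma_algebra.
exists [:: j], (fun=> B); split => //; first by move=> i; rewrite inE => /eqP ->.
by rewrite big_seq1.
Qed.

Lemma cylinders_setI J : setI_closed (cylinders J).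
Proof.
move=> _ _ [s1 [B1 [us1 sJ1 mB1 ->]]] [s2 [B2 [us2 sJ2 mB2 ->]]].
exists (undup (s1 ++ s2)), (fun j => (if j \in s1 then B1 j else setT) `&`
  (if j \in s2 then B2 j else setT)); split.
- exact: undup_uniq.
- by move=> j; rewrite mem_undup mem_cat => /orP[/sJ1|/sJ2].
- by move=> j; apply: measurableI; case: ifP.
- apply/seteqP; split => w.
    move=> [/big_setIP h1 /big_setIP h2]; apply/big_setIP => j _.
    by split; case: ifPn => // js; [exact: h1|exact: h2].
  move=> /big_setIP h; split; apply/big_setIP => j js.
    by have [|] := h j; rewrite ?mem_undup ?mem_cat js.
  by have [|_] := h j; rewrite ?mem_undup ?mem_cat js ?orbT.
Qed.

Hypothesis X_indep : mutually_independent X.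

(** Cylinders are stable under intersection and, by independence, meet the two
    events with equal probability; the uniqueness of measures extends this from
    the cylinders to the sigma-algebra that they generate. *)
Lemma cylinders_balanced J i B B' : ~ J i -> measurable B -> measurable B' ->
    P (X i @^-1` B) = P (X i @^-1` B') ->
  forall A, <<s cylinders J >> A ->
    P (A `&` X i @^-1` B) = P (A `&` X i @^-1` B').
Proof.
move=> nJi mB mB' BB'.
have mX C : measurable C -> measurable (X i @^-1` C).
  by move=> mC; rewrite -[Y in measurable Y]setTI; exact: measurable_funP.
have prod C (mC : measurable C) s (D : I -> set R) : uniq s ->
    (forall j, j \in s -> J j) -> (forall j, measurable (D j)) ->
    P ((\big[setI/setT]_(j <- s) X j @^-1` D j) `&` X i @^-1` C) =
    (P (X i @^-1` C) * \prod_(j <- s) P (X j @^-1` D j))%E.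
  move=> us sJ mD; pose D' j := if j == i then C else D j.
  have nis : i \notin s by apply/negP => /sJ.
  have D'E j : j \in s -> D' j = D j.
    by move=> js; rewrite /D'; case: eqP => // ji; rewrite -ji js in nis.
  have := @X_indep (i :: s) D'; rewrite !big_cons.
  have -> : D' i = C by rewrite /D' eqxx.
  rewrite (eq_big_seq (fun j => X j @^-1` D j)); last by move=> j /D'E ->.
  rewrite (eq_big_seq (fun j => P (X j @^-1` D j))); last by move=> j /D'E ->.
  rewrite setIC => -> //=; first by rewrite nis.
  by move=> j; rewrite /D'; case: ifP.
pose m1 := mrestr P (mX B mB); pose m2 := mrestr P (mX B' mB').
move=> A GA.
apply: (g_sigma_algebra_measure_unique (cylinders J) _ (fun=> setT) _ _ m1 m2) GA.
- by move=> C hC; apply: (@cylinders_measurable J); exact: sub_sigma_algebra.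
- by move=> _; exists [::], (fun=> setT); split => //; rewrite big_nil.
- by rewrite bigcup_const//; exists 0.
- exact: cylinders_setI.
- move=> _ [s [D [us sJ mD ->]]].
  apply: (etrans (prod B mB s D us sJ mD)); rewrite BB'; apply/esym.
  exact: (prod B' mB' s D us sJ mD).
- move=> k; have : (P (setT `&` X i @^-1` B) < +oo)%E; last exact.
  by rewrite setTI ltey_eq fin_num_measure//; exact: (mX B mB).
Qed.

End Cylinders.

(** * Measurability of continuous functions of several variables *)

Section MeasurableComposition.
Variables (d : measure_display) (T : measurableType d) (R : realType).

Lemma measurable_inv (g : T -> R) : measurable_fun setT g ->
  measurable_fun setT (fun w => (g w)^-1).
Proof.
move=> mg; apply: (@measurableT_comp _ _ _ _ _ _ (@GRing.inv R)) => //.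
rewrite (_ : [set: R] = [set 0] `|` ~` [set 0]); last by rewrite setUv.
apply/measurable_funU => //; first exact: measurableC.
split; first exact: measurable_fun_set1.
apply: open_continuous_measurable_fun; first exact/closed_openC/closed_eq.
by move=> x; rewrite inE /= => /eqP x0; exact: inv_continuous.
Qed.

(** An open set of vectors is a countable union of boxes with rational centre
    and rational width, and the preimage of a box is an intersection of
    coordinate events. *)
Lemma measurable_continuous_rV (K : nat) (f : 'rV[R]_K -> R) (x : T -> 'rV[R]_K) :
    continuous f -> (forall k, measurable_fun setT (fun w => x w 0 k)) ->
  measurable_fun setT (fun w => f (x w)).
Proof.
move=> cf mx mT; apply: (measurability _ (RGenOInfty.measurableE R)) => //
=> _ [_ [a ->] <-]; rewrite setTI.
pose U := f @^-1` `]a, +oo[%classic.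
have oU : open U by apply: open_comp => // y _; exact: cf.
(* The norm on vectors being the maximum norm, its balls are these boxes. *)
pose box (q : 'rV[rat]_K * rat) : set 'rV[R]_K :=
  [set y | forall k, `|y 0 k - ratr (q.1 0 k)| < ratr q.2].
pose F q := if pselect (box q `<=` U) then x @^-1` box q else set0.
have -> : (fun w => f (x w)) @^-1` `]a, +oo[%classic = \bigcup_q F q.
  apply/seteqP; split => w /=; last first.
    by move=> [q _]; rewrite /F; case: pselect => // qU /qU.
  move=> Uxw; have /nbhs_ballP[e /= e0 xe] := open_nbhs_nbhs (conj oU (Uxw : U (x w))).
  have [r /[!in_itv]/= /andP[r0 re]] : exists r, ratr r \in `]0, e / 2[.
    by apply: rat_in_itvoo; rewrite divr_gt0.
  have /choice[q qP] k : exists c, `|x w 0 k - ratr c| < ratr r.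
    have [|c] := @rat_in_itvoo R (x w 0 k - ratr r) (x w 0 k + ratr r); first by lra.
    rewrite in_itv /= => /andP[c1 c2]; exists c; rewrite ltr_norml; apply/andP; split; lra.
  exists (\row_k q k, r) => //.
  have xb : box (\row_k q k, r) (x w) by move=> k; rewrite /= mxE.
  rewrite /F; case: pselect => // -[] y yb; apply: xe.
  rewrite -ball_normE /=; apply: (@le_lt_trans _ _ (2 * ratr r)); last by lra.
  apply: norm_le_coord; first by lra.
  move=> k; have := yb k; have := xb k; rewrite /= !mxE => h1 h2.
  have -> : x w 0 k - y 0 k = (x w 0 k - ratr (q k)) - (y 0 k - ratr (q k)) by ring.
  by rewrite (le_trans (ler_normB _ _))//; lra.
apply: countable_bigcupT_measurable; first exact: countableP.
move=> q; rewrite /F; case: pselect => [?|?] /=; last exact: measurable0.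
have -> : x @^-1` box q = \big[setI/setT]_(k < K)
    (setT `&` (fun w => x w 0 k - ratr (q.1 0 k)) @^-1` `]- ratr q.2, ratr q.2[).
  apply/seteqP; split => w.
    move=> h; apply/big_setIP => k _; split => //=.
    by rewrite in_itv /= -ltr_norml; exact: h.
  move=> /big_setIP h k; have [_] := h k (mem_index_enum k).
  by rewrite /= in_itv /= -ltr_norml.
apply: bigsetI_measurable => k _.
by apply: (measurable_funB (mx k) (measurable_cst _)).
Qed.

End MeasurableComposition.

(** * The trajectories of the algorithm *)

(** Once [q t] is at most one half the recursion contracts, up to the constant
    [A]; before that there are finitely many steps.  The bound does not depend
    on [u], so that it holds for all paths simultaneously. *)
Lemma affine_recursion_bounded (R : realType) (A : R) (q : nat -> R) :
    0 <= A -> (forall t, 0 <= q t) -> q t @[t --> \oo] --> 0 ->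
  exists B, forall u : nat -> R, u 0%N <= A ->
    (forall t, u t.+1 <= A + q t * u t) -> forall t, u t <= B.
Proof.
move=> A0 q0 qcvg.
pose v := fix v t := if t is t'.+1 then A + q t' * v t' else A.
have v0 t : 0 <= v t by elim: t => //= t vt; rewrite addr_ge0// mulr_ge0.
have [N _ qN] : \forall t \near \oo, q t <= 2^-1.
  have /cvgrPdist_le/(_ 2^-1 ltac:(by rewrite invr_gt0)) := qcvg.
  by apply: filterS => t; rewrite sub0r normrN ger0_norm.
pose B := 2 * A + \sum_(0 <= t < N.+1) v t.
exists B => u u0 uS.
have uv t : u t <= v t.
  elim: t => //= t ih; rewrite (le_trans (uS t))// lerD2l.
  by rewrite ler_wpM2l.
have small t : (t <= N)%N -> u t <= B.
  move=> tN; rewrite (le_trans (uv t))// /B big_mkord.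
  rewrite (bigD1 (Ordinal (tN : (t < N.+1)%N)))//= addrCA lerDl addr_ge0//.
    by rewrite mulr_ge0.
  exact: sumr_ge0.
have B2 : 2 * A <= B by rewrite lerDl sumr_ge0.
elim=> [|t ih]; first exact: small.
have [tN|Nt] := leqP t.+1 N; first exact: small.
rewrite (le_trans (uS t))//.
have qt : q t <= 2^-1 by apply: qN.
have : q t * u t <= q t * B by rewrite ler_wpM2l.
have : q t * B <= 2^-1 * B by rewrite ler_wpM2r//; lra.
lra.
Qed.

Lemma divn_cvg (tau : nat) : (2 <= tau)%N ->
  (t %/ tau)%N @[t --> \oo] --> \oo.
Proof.
move=> tau2; apply/cvgnyPge => A; exists (A * tau)%N => // t /= At.
by rewrite leq_divRL//; lia.
Qed.

Section Trajectories.
Variables (R : realType) (T : Type) (K tau : nat) (q : 'I_K -> nat).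
Hypotheses (tau_ge2 : (2 <= tau)%N) (q_lt : forall k, (q k < tau)%N).

Definition tick (k : 'I_K) (n : nat) : nat := (n * tau + q k)%N.

Variables (f : 'rV[R]_K -> R) (gamma eps : nat -> R).
Variables (a eta : 'I_K -> nat -> T -> R) (X : nat -> T -> 'rV[R]_K).

Definition gradient_estimate k n w : R :=
  (f (X (tick k n).+1 w) - f (X (tick k n) w) + eta k n w) /
  (X (tick k n).+1 w 0 k - X (tick k n) w 0 k).

(** The algorithm with time running over the natural numbers: agent [k] moves
    off his value of time [tick k n] for one step, and then replaces it. *)
Record trajectory (x0 : 'rV[R]_K) : Prop := Trajectory {
  trajectory0 : forall w, X 0%N w = x0;
  trajectory_experiment : forall k n w,
    X (tick k n).+1 w 0 k = X (tick k n) w 0 k + a k n w * eps n;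
  trajectory_update : forall k n w,
    X (tick k n).+2 w 0 k =
    X (tick k n) w 0 k + gradient_estimate k n w * gamma n;
  trajectory_keep : forall k t w,
    (forall n, t != tick k n /\ t != (tick k n).+1) ->
    X t.+1 w 0 k = X t w 0 k
}.

Lemma tickS k n : tick k n.+1 = (tick k n + tau)%N.
Proof. by rewrite /tick mulSn; lia. Qed.

Lemma tick_le k m n : (m <= n)%N -> (tick k m <= tick k n)%N.
Proof. by move=> mn; rewrite /tick leq_add2r leq_mul2r mn orbT. Qed.

Lemma tick_lt k m n : (tick k m < tick k n)%N = (m < n)%N.
Proof. by rewrite /tick ltn_add2r ltn_mul2r (leq_trans _ tau_ge2). Qed.

Lemma tick_div k n : (tick k n %/ tau = n)%N.
Proof. by rewrite /tick divnMDl ?divn_small ?addn0//; lia. Qed.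

Variable x0 : 'rV[R]_K.
Hypothesis X_traj : trajectory x0.

Lemma step_cases k t w :
  [\/ exists2 n, t = tick k n & X t.+1 w 0 k = X t w 0 k + a k n w * eps n,
      exists2 n, t = (tick k n).+1 &
        X t.+1 w 0 k = X (tick k n) w 0 k + gradient_estimate k n w * gamma n |
      X t.+1 w 0 k = X t w 0 k].
Proof.
have [[n tn]|h1] := pselect (exists n, t = tick k n).
  by apply: Or31; exists n => //; rewrite tn (trajectory_experiment X_traj).
have [[n tn]|h2] := pselect (exists n, t = (tick k n).+1).
  by apply: Or32; exists n => //; rewrite tn (trajectory_update X_traj).
apply: Or33; apply: (trajectory_keep X_traj) => n.
by split; apply/eqP => tn; [apply: h1|apply: h2]; exists n.
Qed.

Lemma hold_before k t w : (t <= tick k 0)%N -> X t w 0 k = X 0%N w 0 k.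
Proof.
elim: t => // t ih tk; rewrite -(ih (ltnW tk)).
apply: (trajectory_keep X_traj) => n; have := @tick_le k 0 n isT.
by split; apply/eqP; lia.
Qed.

Lemma hold_between k n t w : ((tick k n).+2 <= t <= tick k n.+1)%N ->
  X t w 0 k = X (tick k n).+2 w 0 k.
Proof.
elim: t => // t ih /andP[]; rewrite leq_eqVlt => /predU1P[<-//|nt] tn.
rewrite -ih; last by rewrite -ltnS nt ltnW.
apply: (trajectory_keep X_traj) => m.
by have [mn|nm] := leqP m n; [have := tick_le k mn|have := tick_le k nm];
  split; apply/eqP; lia.
Qed.

(** The values from which the agents start their [n]-th experiments.  They are
    taken at different times; since an update discards the experiment, the next
    such value differs from this one by the gradient step alone. *)
Definition base_point n w : 'rV[R]_K := \row_k X (tick k n) w 0 k.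

Lemma base_pointS k n w :
  base_point n.+1 w 0 k = base_point n w 0 k + gradient_estimate k n w * gamma n.
Proof.
rewrite !mxE -(trajectory_update X_traj); apply: hold_between.
by rewrite leqnn andbT tickS; lia.
Qed.

(** Slots are taken open on the left and closed on the right: when
    [q k = tau - 1], the update of agent [k] that ends slot [n - 1] becomes
    visible only at time [n * tau + 1]. *)
Lemma slot_coord k n t w : (n * tau < t <= n.+1 * tau)%N ->
  [\/ X t w 0 k = base_point n w 0 k,
      t = (tick k n).+1 /\ X t w 0 k = base_point n w 0 k + a k n w * eps n |
      X t w 0 k = base_point n w 0 k + gradient_estimate k n w * gamma n].
Proof.
move=> /andP[nt tn]; have qk := q_lt k; rewrite -base_pointS !mxE.
have [tk|kt] := leqP t (tick k n).
  apply: Or31; case: n nt tn tk => [|n] nt tn tk.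
    by rewrite (hold_before w tk) hold_before.
  have e : (tick k n).+2 = (n * tau + q k + 2)%N by rewrite /tick addn2.
  have h : ((tick k n).+2 <= t)%N by move: nt; rewrite mulSn e; lia.
  rewrite (@hold_between k n t) ?h// (@hold_between k n (tick k n.+1))//.
  by rewrite (leq_trans h tk) leqnn.
have [tk|kt2] := leqP t (tick k n).+1.
  have -> : t = (tick k n).+1 by apply/eqP; rewrite eqn_leq tk.
  by apply: Or32; split => //; rewrite (trajectory_experiment X_traj).
have h : (t <= tick k n.+1)%N by move: tn; rewrite /tick !mulSn; lia.
apply: Or33; rewrite (@hold_between k n t) ?kt2// (@hold_between k n (tick k n.+1))//.
by rewrite (leq_trans kt2 h) leqnn.
Qed.


(** * Decomposition of the gradient estimate *)

(** The scale of the noise of an update: an observation of size 1 is divided by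
    [eps n] and multiplied by [gamma n]. *)
Definition rho n : R := gamma n / eps n.

(** The state just after the [n]-th experiment of agent [k], with that
    experiment undone; simultaneous moves of the others are kept. *)
Definition reset k n w : 'rV[R]_K :=
  \row_j (if j == k then X (tick k n) w 0 k else X (tick k n).+1 w 0 j).

Definition probe (s : R) k n w : R := f (reset k n w + (s * eps n) *: delta_mx 0 k).

Definition central_quotient k n w : R :=
  (probe 1 k n w - probe (-1) k n w) / (2 * eps n).

Definition noise k n w : R :=
  rho n * ((probe 1 k n w + probe (-1) k n w) / 2 - f (X (tick k n) w) + eta k n w).

Hypothesis gamma_gt0 : forall n, 0 < gamma n.
Hypothesis eps01 : forall n, 0 < eps n < 1.

Let eps_gt0 n : 0 < eps n. Proof. by case/andP: (eps01 n). Qed.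

Lemma rho_gt0 n : 0 < rho n. Proof. by rewrite divr_gt0. Qed.

Lemma probeE k n w : f (X (tick k n).+1 w) = probe (a k n w) k n w.
Proof.
congr f; apply/rowP => j; rewrite !mxE eqxx /=.
case: eqP => [->|_]; last by rewrite mulr0 addr0.
by rewrite mulr1 (trajectory_experiment X_traj).
Qed.

Lemma gradient_estimateE k n w : gradient_estimate k n w =
  (probe (a k n w) k n w - f (X (tick k n) w) + eta k n w) / (a k n w * eps n).
Proof.
rewrite /gradient_estimate probeE (trajectory_experiment X_traj).
by congr (_ / _); ring.
Qed.

(** Splitting the observed value [probe a] into its even and odd parts in the
    sign [a]: the odd part divided by [a] no longer involves [a], and the even
    part, like everything else, is multiplied by [a]. *)
Lemma gradient_decomposition k n w : a k n w = 1 \/ a k n w = -1 ->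
  gradient_estimate k n w * gamma n =
  gamma n * central_quotient k n w + a k n w * noise k n w.
Proof.
have e0 : eps n != 0 by rewrite gt_eqF.
rewrite gradient_estimateE /noise /central_quotient /rho.
by case=> ->; field.
Qed.

(** * Bounds along a path *)

Variables (L C : R).
Hypothesis f_lip : forall x y, `|f x - f y| <= L * `|x - y|.
Hypotheses (L_ge0 : 0 <= L) (C_ge0 : 0 <= C).
Hypothesis rho_cvg0 : rho n @[n --> \oo] --> 0.

Definition bounded_path w :=
  (forall k n, a k n w = 1 \/ a k n w = -1) /\ (forall k n, `|eta k n w| <= C).

Lemma norm_sign k n w : bounded_path w -> `|a k n w| = 1.
Proof. by move=> [/(_ k n) + _] => -[->|->]; rewrite ?normrN normr1. Qed.

Lemma update_le k n w : bounded_path w ->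
  `|gradient_estimate k n w * gamma n| <=
    rho n * (L * `|X (tick k n).+1 w - X (tick k n) w| + C).
Proof.
move=> bw; have e0 := eps_gt0 n; have g0 := gamma_gt0 n.
rewrite gradient_estimateE -probeE !normrM normfV normrM norm_sign// mul1r.
rewrite (gtr0_norm e0) (gtr0_norm g0) /rho [leRHS]mulrC mulrAC -mulrA ler_wpM2r//.
  by rewrite divr_ge0// ltW.
by rewrite (le_trans (ler_normD _ _))// lerD//; case: bw.
Qed.

(** The size of an update depends on the last increment of the whole state,
    which contains earlier updates of the others; this feedback has the factor
    [rho n * L], which tends to 0. *)
Lemma increment_bounded : exists2 B, 0 <= B & forall w, bounded_path w ->
  forall t, `|X t.+1 w - X t w| <= B.
Proof.
have [rbar rb] : exists rbar, forall n, rho n <= rbar.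
  have [M [_ MP]] := cvg_seq_bounded (cvgP _ rho_cvg0).
  exists (M + 1) => n; rewrite (le_trans (ler_norm _))//.
  by apply: (MP (M + 1)) => //; rewrite ltrDl.
have rbar0 : 0 <= rbar by rewrite (le_trans _ (rb 0%N))// ltW// rho_gt0.
pose A := 1 + rbar * C.
have A0 : 0 <= A by rewrite addr_ge0// mulr_ge0.
pose u t := rho (t %/ tau)%N * L.
have u0 t : 0 <= u t by rewrite mulr_ge0// ltW// rho_gt0.
have ucvg : u t @[t --> \oo] --> 0.
  rewrite -(mul0r L); apply: cvgMl; exact: (cvg_comp _ _ (divn_cvg tau_ge2) rho_cvg0).
have [B HB] := affine_recursion_bounded A0 u0 ucvg.
exists `|B| => // w bw t; rewrite (le_trans _ (ler_norm B))//.
have ae1 k n : `|a k n w * eps n| <= 1.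
  by rewrite normrM norm_sign// mul1r gtr0_norm// ltW//; case/andP: (eps01 n).
have A1 : 1 <= A by rewrite lerDl mulr_ge0.
move: t; apply: (HB (fun t => `|X t.+1 w - X t w|)) => [|t].
  apply: norm_le_coord => // k; rewrite !mxE; case: (step_cases k 0 w).
  - by move=> [n tn ->]; rewrite addrAC subrr add0r (le_trans (ae1 k n)).
  - by move=> [].
  - by move=> ->; rewrite subrr normr0.
apply: norm_le_coord => [|k].
  by rewrite addr_ge0// mulr_ge0.
rewrite !mxE; case: (step_cases k t.+1 w).
- move=> [n tn ->]; rewrite addrAC subrr add0r (le_trans (ae1 k n))//.
  by rewrite (le_trans A1)// lerDl mulr_ge0.
- move=> [n [tn] ->]; rewrite tn (trajectory_experiment X_traj).
  rewrite opprD addrACA subrr add0r /u tick_div /A.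
  have := update_le k n bw; set Y := `|X _ w - _|; have := ae1 k n => h1 h2.
  have h3 : rho n * C <= rbar * C by rewrite ler_wpM2r.
  by rewrite (le_trans (ler_normB _ _))//; move: h1 h2 h3; lra.
- by move=> ->; rewrite subrr normr0 addr_ge0// mulr_ge0.
Qed.

Variable B : R.
Hypothesis B_ge0 : 0 <= B.
Hypothesis incr_le : forall w, bounded_path w -> forall t, `|X t.+1 w - X t w| <= B.

Lemma slot_dist n t w : bounded_path w -> (n * tau < t <= n.+1 * tau)%N ->
  `|X t w - base_point n w| <= eps n + rho n * (L * B + C).
Proof.
move=> bw tn; have e0 := eps_gt0 n; have r0 := rho_gt0 n.
have LBC : 0 <= L * B + C by rewrite addr_ge0// mulr_ge0.
have rL : 0 <= rho n * (L * B + C) by rewrite mulr_ge0// ltW.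
apply: norm_le_coord => [|k]; first by rewrite addr_ge0// ltW.
rewrite mxE [X in _ + X]mxE; case: (slot_coord k w tn) => [->|[_ ->]|->].
- by rewrite subrr normr0 addr_ge0// ltW.
- rewrite addrAC subrr add0r normrM norm_sign// mul1r gtr0_norm//.
  by rewrite lerDl.
- rewrite addrAC subrr add0r (le_trans (update_le k n bw))//.
  rewrite (@le_trans _ _ (rho n * (L * B + C)))//; last by rewrite lerDr ltW.
  by rewrite ler_pM2l// lerD2r ler_wpM2l// incr_le.
Qed.

Lemma reset_dist k n w : bounded_path w ->
  `|reset k n w - X (tick k n) w| <= B.
Proof.
move=> bw; apply: norm_le_coord => // j; rewrite !mxE.
case: eqP => [->|_]; first by rewrite subrr normr0.
have := le_trans (coord_le_norm _ j) (incr_le bw (tick k n)).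
by rewrite !mxE.
Qed.

Lemma noise_le k n w : bounded_path w ->
  `|noise k n w| <= rho n * (L * (B + 1) + C).
Proof.
move=> bw; have r0 := rho_gt0 n.
rewrite normrM (gtr0_norm r0) ler_pM2l//.
have pr (s : R) : `|s| = 1 -> `|probe s k n w - f (X (tick k n) w)| <= L * (B + 1).
  move=> s1; rewrite (le_trans (f_lip _ _))// ler_wpM2l//.
  rewrite addrAC (le_trans (ler_normD _ _))// lerD ?reset_dist//.
  rewrite normrZ normrM s1 mul1r gtr0_norm// mulr_ile1//; first exact: ltW.
    by rewrite ltW//; case/andP: (eps01 n).
  apply: norm_le_coord => // j; rewrite mxE eqxx /=.
  by case: eqP => _; rewrite ?normr1 ?normr0.
rewrite (le_trans (ler_normD _ _))// lerD//; last by case: bw.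
have := pr 1 (normr1 _); have := pr (-1); rewrite normrN normr1 => /(_ erefl).
rewrite !ler_norml => /andP[? ?] /andP[? ?]; apply/andP; split; lra.
Qed.

Hypothesis f_diff : forall x, differentiable f x.
Variable D : R.
Hypothesis D_ge0 : 0 <= D.
Hypothesis df_lip : forall k x y, `|partial k f x - partial k f y| <= D * `|x - y|.

(** By the mean value theorem the quotient is a partial derivative at a point
    within [eps n] of [reset k n w], whose coordinates are those of an iterate
    of slot [n], or of the base point itself. *)
Lemma central_quotient_bias k n w : bounded_path w ->
  `|central_quotient k n w - partial k f (base_point n w)| <=
    D * (2 * eps n + rho n * (L * B + C)).
Proof.
move=> bw; have e0 := eps_gt0 n; have r0 := rho_gt0 n.
pose y := reset k n w - eps n *: delta_mx 0 k.
pose v : 'rV[R]_K := (2 * eps n) *: delta_mx 0 k.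
have [t t01 E] := mean_value y v f_diff.
have -> : central_quotient k n w = partial k f (y + t *: v).
  rewrite /central_quotient /probe mulN1r scaleNr -/y mul1r.
  have -> : reset k n w + eps n *: delta_mx 0 k = y + v.
    by rewrite /y /v -addrA; congr (_ + _); rewrite mulr2n mulrDl !mul1r scalerDl addKr.
  rewrite E (derive_partial _ (f_diff _)) (bigD1 k)//= big1 ?addr0; last first.
    by move=> j jk; rewrite !mxE (negPf jk) andbF mulr0 mul0r.
  by rewrite !mxE !eqxx mulr1; field; rewrite gt_eqF.
rewrite (le_trans (df_lip _ _ _))// ler_wpM2l//.
have -> : y + t *: v - base_point n w =
    (reset k n w - base_point n w) + ((2 * t - 1) * eps n) *: delta_mx 0 k.
  by rewrite /y /v; apply/rowP => j; rewrite !mxE; ring.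
rewrite (le_trans (ler_normD _ _))//.
have : `|((2 * t - 1) * eps n) *: (delta_mx 0 k : 'rV[R]_K)| <= eps n.
  apply: norm_le_coord => [|j]; first exact: ltW.
  rewrite !mxE eqxx /=; case: eqP => _; last by rewrite mulr0 normr0 ltW.
  rewrite mulr1 normrM (gtr0_norm e0) ger_pMl//.
  by move: t01; rewrite in_itv /= ler_norml => /andP[? ?]; apply/andP; split; lra.
have : `|reset k n w - base_point n w| <= eps n + rho n * (L * B + C).
  have tn : (n * tau < (tick k n).+1 <= n.+1 * tau)%N.
    by rewrite /tick mulSn; have := q_lt k; lia.
  have := slot_dist bw tn; have n0 := normr_ge0 (X (tick k n).+1 w - base_point n w).
  move=> h; have h0 := le_trans n0 h; apply: norm_le_coord => // j.
  rewrite !mxE; case: eqP => [->|_]; first by rewrite subrr normr0.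
  apply: le_trans h.
  by have := coord_le_norm (X (tick k n).+1 w - base_point n w) j; rewrite !mxE.
lra.
Qed.

End Trajectories.

(** * Measurability of the noise factor *)

Section TrajectoryMeasurability.
Variables (R : realType) (d : measure_display) (T : measurableType d).
Variables (K tau : nat) (q : 'I_K -> nat).
Hypotheses (tau_ge2 : (2 <= tau)%N).
Variables (f : 'rV[R]_K -> R) (gamma eps : nat -> R).
Variables (a eta : 'I_K -> nat -> T -> R) (X : nat -> T -> 'rV[R]_K).
Variable x0 : 'rV[R]_K.
Hypothesis X_traj : trajectory tau q f gamma eps a eta X x0.
Hypothesis f_cont : continuous f.
Hypothesis eta_measurable : forall k n, measurable_fun setT (eta k n).

Local Notation tick := (tick tau q).
Local Notation coord_measurable t :=
  (forall j, measurable_fun setT (fun w => X t w 0 j)).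

Lemma step_measurable k t :
    (forall s, (s <= t)%N -> coord_measurable s) ->
    (forall n, t = tick k n -> measurable_fun setT (a k n)) ->
  measurable_fun setT (fun w => X t.+1 w 0 k).
Proof.
move=> mX ma.
have [[n tn]|h1] := pselect (exists n, t = tick k n).
  have -> : (fun w => X t.+1 w 0 k) = (fun w => X t w 0 k + a k n w * eps n).
    by apply/funext => w; rewrite tn (trajectory_experiment X_traj).
  apply: measurable_funD; first exact: mX.
  by apply: measurable_funM; [exact: ma|exact: measurable_cst].
have [[n tn]|h2] := pselect (exists n, t = (tick k n).+1); last first.
  have -> : (fun w => X t.+1 w 0 k) = (fun w => X t w 0 k); last exact: mX.
  apply/funext => w; apply: (trajectory_keep X_traj) => n.
  by split; apply/eqP => tn; [apply: h1|apply: h2]; exists n.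
have -> : (fun w => X t.+1 w 0 k) = (fun w => X (tick k n) w 0 k +
    gradient_estimate tau q f eta X k n w * gamma n).
  by apply/funext => w; rewrite tn (trajectory_update X_traj).
have m0 : coord_measurable (tick k n) by apply: mX; rewrite tn.
have m1 : coord_measurable (tick k n).+1 by apply: mX; rewrite tn.
apply: measurable_funD => //; apply: measurable_funM; last exact: measurable_cst.
apply: measurable_funM.
  apply: measurable_funD => //; apply: measurable_funB;
    exact: measurable_continuous_rV.
by apply: measurable_inv; apply: measurable_funB.
Qed.

Lemma trajectory_measurable t0 :
    (forall k n, (tick k n < t0)%N -> measurable_fun setT (a k n)) ->
  forall t, (t <= t0)%N -> coord_measurable t.
Proof.
move=> ma; suff H t : (t <= t0)%N -> forall s, (s <= t)%N -> coord_measurable s.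
  by move=> t tt0; apply: (H t tt0 t).
elim: t => [_ s|t ih tt0 s].
  rewrite leqn0 => /eqP -> j.
  by under eq_fun do rewrite (trajectory0 X_traj); exact: measurable_cst.
rewrite leq_eqVlt => /predU1P[-> j|]; last by rewrite ltnS; apply: ih; exact: ltnW.
apply: step_measurable => [|n tn]; first by apply: ih; exact: ltnW.
by apply: ma; rewrite -tn.
Qed.

(** The noise factor sees other agents' signs, even simultaneous ones, but of
    agent [k] only the earlier signs: in [reset] his coordinate is the one
    before the experiment.  Read with a sub-sigma-algebra as the measurable
    structure of [T], this says that the factor is predictable. *)
Lemma noise_measurable k n :
    (forall j i, j != k \/ (i < n)%N -> measurable_fun setT (a j i)) ->
  measurable_fun setT (noise tau q f gamma eps eta X k n).
Proof.
move=> ma.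
have mX : forall t, (t <= tick k n)%N -> coord_measurable t.
  apply: trajectory_measurable => j i ji; apply: ma.
  have [jk|] := eqVneq j k; last by left.
  by right; move: ji; rewrite jk tick_lt.
have mreset j : measurable_fun setT (fun w => reset tau q X k n w 0 j).
  under eq_fun do rewrite mxE.
  case: eqP => [_|/eqP jk]; first exact: mX.
  by apply: step_measurable => // i _; apply: ma; left.
have mprobe s : measurable_fun setT (probe tau q f eps X s k n).
  apply: (@measurable_continuous_rV _ _ _ _ f) => // j.
  under eq_fun do rewrite mxE.
  by apply: measurable_funD => //; exact: measurable_cst.
apply: measurable_funM; first exact: measurable_cst.
apply: measurable_funD => //; apply: measurable_funB; last first.
  by apply: measurable_continuous_rV => //; exact: mX.
by apply: measurable_funM; [exact: measurable_funD|exact: measurable_cst].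
Qed.

End TrajectoryMeasurability.

(** * The algorithm in natural-number time *)

Section NaturalTime.
Variables (R : realType) (T : Type) (K tau : nat) (p : 'I_K -> 'I_tau).
Variables (f : 'rV[R]_K -> R) (gamma eps : nat -> R).
Variables (a eta : 'I_K -> nat -> T -> R) (x : int -> T -> 'rV[R]_K).

(** The time shift by one makes the initial time -1 of the algorithm the time 0
    of a trajectory, and the phase [tau - 1] the phase 0. *)
Definition phase (k : 'I_K) : nat := if p k == tau.-1 :> nat then 0 else (p k).+1.

Lemma phase_lt k : (phase k < tau)%N.
Proof. by rewrite /phase; have := ltn_ord (p k); case: eqP; lia. Qed.

Lemma kw_timeE k n : kw_time p k n = (tick tau phase k n)%:Z - 1.
Proof.
by rewrite /kw_time /tick /phase; have := ltn_ord (p k); case: eqP; lia.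
Qed.

Lemma kw_trajectory x0 : kw_iterates p f gamma eps a eta x x0 ->
  trajectory tau phase f gamma eps a eta (fun t => x (t%:Z - 1)) x0.
Proof.
move=> [init experiment update keep].
have T1 k n : kw_time p k n + 1 = (tick tau phase k n).+1%:Z - 1.
  by rewrite kw_timeE; lia.
have T2 k n : kw_time p k n + 2 = (tick tau phase k n).+2%:Z - 1.
  by rewrite kw_timeE; lia.
split.
- by move=> w; rewrite sub0r init.
- by move=> k n w; have := experiment k n w; rewrite /= T1 kw_timeE.
- move=> k n w; have := update k n w.
  by rewrite /= /kw_gradient T1 T2 kw_timeE.
- move=> k t w h; have := keep k (t%:Z - 1) w.
  have -> : t%:Z - 1 + 1 = t.+1%:Z - 1 by lia.
  apply; first by lia.
  move=> n; have [h1 h2] := h n; rewrite T1 T2.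
  by split; apply/eqP => e; [move/eqP: h1|move/eqP: h2]; apply; lia.
Qed.

End NaturalTime.

(** * Step sizes *)

Section StepSizes.
Variable R : realType.

Lemma partial_sum_le_total (u : nat -> R) : (forall n, 0 <= u n) ->
    (\sum_(0 <= n <oo) (u n)%:E < +oo)%E ->
  exists B, forall n, \sum_(0 <= i < n) u i <= B.
Proof.
move=> u0 ult.
have s0 : (0 <= \sum_(0 <= n <oo) (u n)%:E)%E.
  by apply: nneseries_ge0 => n _ _; rewrite lee_fin.
exists (fine (\sum_(0 <= n <oo) (u n)%:E)%E) => n.
rewrite -lee_fin fineK ?ge0_fin_numE// -sumEFin.
by apply: nneseries_lim_ge => i _ _; rewrite lee_fin.
Qed.

Lemma summable_sqr_cvg0 (u : nat -> R) (B : R) : (forall n, 0 <= u n) ->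
  (forall n, \sum_(0 <= i < n) u i ^+ 2 <= B) -> u n @[n --> \oo] --> 0.
Proof.
move=> u0 uB.
have cS : cvgn (series (fun i => u i ^+ 2)).
  apply: nondecreasing_is_cvgn.
    apply/nondecreasing_seqP => n; rewrite /series /= big_nat_recr//= lerDl.
    exact: sqr_ge0.
  by exists B => _ [n _ <-]; exact: uB.
have /cvgrPdist_lt u2 := cvg_series_cvg_0 cS.
apply/cvgrPdist_lt => e e0; near=> n; rewrite sub0r normrN ger0_norm//.
have : `|0 - u n ^+ 2| < e ^+ 2 by near: n; apply: u2; rewrite exprn_gt0.
by rewrite sub0r normrN ger0_norm ?sqr_ge0// ltr_pXn2r ?nnegrE ?(ltW e0)//.
Unshelve. all: by end_near. Qed.

Lemma partial_sum_unbounded (u : nat -> R) : (forall n, 0 <= u n) ->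
    (\sum_(0 <= n <oo) (u n)%:E = +oo)%E ->
  forall A, exists n, A < \sum_(0 <= i < n) u i.
Proof.
move=> u0 uoo A; apply: contrapT => /forallNP h.
suff : (\sum_(0 <= n <oo) (u n)%:E <= A%:E)%E by rewrite uoo.
apply: lime_le; first by apply: is_cvg_nneseries => n _ _; rewrite lee_fin.
apply: nearW => n; rewrite sumEFin lee_fin leNgt; apply/negP; exact: h.
Qed.

End StepSizes.

(** * Almost sure convergence *)

Section SignNoise.
Variables (R : realType) (d : measure_display) (T : measurableType d).
Variables (P : probability T R) (A : eqType) (a eta : A -> nat -> {RV P >-> R}).
Hypothesis indep : mutually_independent (join_families a eta).
Hypothesis a_minus : forall k n, P [set w | a k n w = -1] = (2^-1 : R)%:E.
Hypothesis a_plus : forall k n, P [set w | a k n w = 1] = (2^-1 : R)%:E.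

Lemma signs_ae k n : {ae P, forall w, a k n w = 1 \/ a k n w = -1}.
Proof.
have m1 (r : R) : measurable [set w | a k n w = r].
  have -> : [set w | a k n w = r] = setT `&` a k n @^-1` [set r] by rewrite setTI.
  exact: measurable_funP.
pose U := [set w | a k n w = 1] `|` [set w | a k n w = -1].
have mU : measurable U by exact: measurableU.
have PU : P U = 1%E.
  have half2 : 2^-1 + 2^-1 = 1 :> R by lra.
  rewrite /U measureU//.
    apply: etrans (f_equal2 adde (a_plus k n) (a_minus k n)) _.
    exact: (congr1 EFin half2).
  by apply/seteqP; split => w //= [-> e]; lra.
exists (~` U); split.
- exact: measurableC.
- by have := probability_setC P mU; rewrite PU subee.
- by move=> w /= nw Uw; apply: nw.
Qed.

(** All variables except the present and future signs of agent [k]; the future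
    signs of the others are included, so that one family of sigma-algebras
    serves whatever the order in which the agents act. *)
Definition all_but_signs_from (k : A) (n : nat) : set (A * nat + A * nat) :=
  [set i | match i with
           | inl jm => jm.1 != k \/ (jm.2 < n)%N
           | inr _ => True
           end].

Lemma sign_noise_cvg k (H : nat -> T -> R) (c : nat -> R) (B : R) :
    (forall n, measurable_fun
      [set: g_sigma_algebraType (cylinders (join_families a eta) (all_but_signs_from k n))] (H n)) ->
    {ae P, forall w, forall n, `|H n w| <= c n} ->
    (forall n, 0 <= c n) ->
    (forall n, \sum_(0 <= i < n) c i ^+ 2 <= B) ->
  {ae P, forall w, cvgn (fun n => \sum_(0 <= i < n) a k i w * H i w)}.
Proof.
move=> mH Hc c0 cB.
pose G n := cylinders (join_families a eta) (all_but_signs_from k n).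
pose U n := a k n @^-1` [set 1]; pose V n := a k n @^-1` [set -1].
(* Truncation changes H only on a null set and makes the bound hold everywhere. *)
pose H' n w := if `|H n w| <= c n then H n w else 0.
have mH' n : measurable_fun [set: g_sigma_algebraType (G n)] (H' n).
  apply: measurable_fun_ifT => //; last exact: mH.
  apply: measurable_fun_ler; last exact: measurable_cst.
  by apply: (measurableT_comp (@normr_measurable R setT)); exact: mH.
have H'c n w : `|H' n w| <= c n.
  by rewrite /H'; case: ifP => //; rewrite normr0.
have GT n C : <<s G n >> C -> measurable C by exact: cylinders_measurable.
have Gnd n C : <<s G n >> C -> <<s G n.+1 >> C.
  apply: cylinders_sub => -[[j m]|//] /= [->|mn]; first by left.
  by right; rewrite ltnS ltnW.
have adapted n r : <<s G n.+1 >> (a k n @^-1` [set r]).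
  rewrite -[X in <<s _ >> X]setTI.
  have /(_ measurableT _ (measurable_set1 r)) := @cylinders_measurable_fun _ _ _ _ _
    (join_families a eta) (all_but_signs_from k n.+1) (inl (k, n)) (or_intror (ltnSn n)).
  exact.
have bal n C : <<s G n >> C -> P (C `&` U n) = P (C `&` V n).
  apply: (@cylinders_balanced _ _ _ _ _ _ indep _ (inl (k, n))) => //.
    by move=> /= []; rewrite ?eqxx// ltnn.
  by apply: etrans (a_plus k n) _; apply/esym; exact: a_minus.
have := sign_transform_cvg GT Gnd (fun n => adapted n 1) (fun n => adapted n (-1))
  bal mH' H'c cB.
have /ae_foralln sgn := signs_ae k.
apply: filterS3 Hc sgn => w Hw aw.
suff -> : (fun n => \sum_(0 <= i < n) a k i w * H i w) =
    sign_transform U V H' ^~ w by [].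
apply/funext => n; apply: eq_bigr => i _.
have -> : H' i w = H i w by rewrite /H' Hw.
congr (_ * _); rewrite /balanced_sign !indicE.
have ne : (1 : R) <> -1 by move=> e; lra.
have ne' : (-1 : R) <> 1 by move=> /esym.
case: (aw i) => e.
  by rewrite mem_set// memNset ?subr0//= /V /= e.
by rewrite memNset ?mem_set ?sub0r//= /U /= e.
Qed.

End SignNoise.

Theorem theorem1 (R : realType) (d : measure_display) (T : measurableType d)
    (P : probability T R) (K : nat) (K_ge1 : (1 <= K)%N)
    (tau : nat) (tau_ge2 : (2 <= tau)%N) (p : 'I_K -> 'I_tau)
    (f : 'rV[R]_K -> R) (xstar : 'rV[R]_K) (L : R)
    (f_concave : concave_function f)
    (xstar_max : forall x, f x <= f xstar)
    (f_strict : exists2 U, nbhs xstar U & strictly_concave_on U f)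
    (f_lipschitz : euclidean_lipschitz L f)
    (f_derivatives : bounded_derivatives23 f)
    (gamma eps : nat -> R)
    (gamma01 : forall n, 0 < gamma n < 1)
    (eps01 : forall n, 0 < eps n < 1)
    (sum_gamma2_eps2 :
      (\sum_(0 <= n <oo) (gamma n ^+ 2 / eps n ^+ 2)%:E < +oo)%E)
    (sum_gamma_eps2 : (\sum_(0 <= n <oo) (gamma n * eps n ^+ 2)%:E < +oo)%E)
    (gamma_eps2_bounded : exists C : R, forall n, gamma n / eps n ^+ 2 <= C)
    (sum_gamma : (\sum_(0 <= n <oo) (gamma n)%:E = +oo)%E)
    (eps_cvg0 : eps n @[n --> \oo] --> (0 : R))
    (a eta : 'I_K -> nat -> {RV P >-> R})
    (indep : mutually_independent (join_families a eta))
    (a_minus : forall k n, P [set w | a k n w = -1] = (2^-1 : R)%:E)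
    (a_plus : forall k n, P [set w | a k n w = 1] = (2^-1 : R)%:E)
    (eta_mean0 : forall k n, ('E_P[eta k n] = 0)%E)
    (eta_bounded : exists C : R, forall k n, {ae P, forall w, `|eta k n w| <= C})
    (x : int -> T -> 'rV[R]_K) (x0 : 'rV[R]_K)
    (x_iterates : kw_iterates p f gamma eps a eta x x0) :
  {ae P, forall w, x n%:Z w @[n --> \oo] --> xstar}.
Proof.
pose e k : 'rV[R]_K := delta_mx 0 k.
have [f_diff pf_diff _ [C2 f2] _] := f_derivatives.
have f_cont : continuous f by move=> y; exact: differentiable_continuous.
have norm_e k : euclidean_norm (e k) = 1.
  rewrite /euclidean_norm (bigD1 k)//= big1 ?addr0; last first.
    by move=> i ik; rewrite mxE (negPf ik) andbF expr0n.
  by rewrite mxE !eqxx expr1n sqrtr1.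
have norm_eN k : euclidean_norm (- e k) = 1.
  by rewrite -[RHS](norm_e k); congr Num.sqrt; apply: eq_bigr => i _; rewrite mxE sqrrN.
have pf_bounded k y : `|partial k f y| <= `|L|.
  rewrite (le_trans _ (ler_norm L))//.
  apply: (concave_partial_bound f_concave (f_diff y)) => i.
    by have := f_lipschitz (y + e i) y; rewrite addrAC subrr add0r norm_e mulr1.
  by have := f_lipschitz (y - e i) y; rewrite addrAC subrr add0r norm_eN mulr1.
pose L' := `|L| * K%:R.
have L'0 : 0 <= L' by rewrite mulr_ge0.
have f_lip : forall y z, `|f y - f z| <= L' * `|y - z|.
  exact: partial_bounded_lipschitz.
pose D := `|C2| * K%:R.
have D0 : 0 <= D by rewrite mulr_ge0.
have pf_lip k y z : `|partial k f y - partial k f z| <= D * `|y - z|.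
  apply: partial_bounded_lipschitz => [|i u]; first exact: pf_diff.
  exact: le_trans (f2 k i u) (ler_norm _).
have [Ce eta_le] := eta_bounded.
pose C := `|Ce|; have C0 : 0 <= C := normr_ge0 Ce.
have gamma_gt0 n : 0 < gamma n by case/andP: (gamma01 n).
have eps_gt0 n : 0 < eps n by case/andP: (eps01 n).
pose r n := rho gamma eps n.
have r_gt0 n : 0 < r n by exact: rho_gt0.
have [S rS] : exists S, forall n, \sum_(0 <= i < n) r i ^+ 2 <= S.
  apply: partial_sum_le_total => [n|]; first exact: sqr_ge0.
  by under eq_eseriesr do rewrite /r /rho expr_div_n.
have r_cvg0 : r n @[n --> \oo] --> 0.
  by apply: (summable_sqr_cvg0 _ rS) => n; exact: ltW.
have gamma_cvg0 : gamma n @[n --> \oo] --> 0.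
  apply: (@squeeze_cvgr _ _ _ _ (fun=> 0) r); [|exact: cvg_cst|exact: r_cvg0].
  apply: nearW => n; rewrite ltW//= ler_pdivlMr// ger_pMr// ltW//.
  by case/andP: (eps01 n).
have gamma_div := partial_sum_unbounded (fun n => ltW (gamma_gt0 n)) sum_gamma.
pose X (t : nat) : T -> 'rV[R]_K := x (t%:Z - 1).
pose q := phase p.
have q_lt : forall k, (q k < tau)%N := phase_lt p.
have X_traj : trajectory tau q f gamma eps a eta X x0 := kw_trajectory x_iterates.
have [B B0 HB] := increment_bounded tau_ge2 q_lt X_traj gamma_gt0 eps01 f_lip
  L'0 C0 r_cvg0.
pose noise_k := noise tau q f gamma eps eta X.
pose c n := r n * (L' * (B + 1) + C).
have c0 n : 0 <= c n.
  by apply: mulr_ge0; [exact: ltW|rewrite addr_ge0// mulr_ge0// addr_ge0].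
have cS n : \sum_(0 <= i < n) c i ^+ 2 <= S * (L' * (B + 1) + C) ^+ 2.
  under eq_bigr do rewrite exprMn.
  by rewrite -mulr_suml ler_wpM2r// sqr_ge0.
have good : {ae P, forall w, bounded_path a eta C w}.
  have h1 : {ae P, forall w, forall k n, a k n w = 1 \/ a k n w = -1}.
    by apply: filter_forall => k; apply/ae_foralln => n; exact: signs_ae.
  have h2 : {ae P, forall w, forall k n, `|eta k n w| <= C}.
    apply: filter_forall => k; apply/ae_foralln => n.
    by apply: filterS (eta_le k n) => w h; exact: le_trans h (ler_norm _).
  by apply: filterS2 h1 h2 => w.
have noise_cvg : {ae P, forall w, forall k,
    cvgn (fun n => \sum_(0 <= i < n) a k i w * noise_k k i w)}.
  apply: filter_forall => k; apply: (sign_noise_cvg indep a_minus a_plus _ _ c0 cS).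
  - move=> n.
    apply: (@noise_measurable R _ (g_sigma_algebraType
      (cylinders (join_families a eta) (all_but_signs_from k n))) K tau q tau_ge2 f gamma eps
      (fun k n => a k n) (fun k n => eta k n) X x0 X_traj f_cont).
      move=> j i; exact: (@cylinders_measurable_fun _ _ _ _ _
        (join_families a eta) (all_but_signs_from k n) (inr (j, i)) I).
    move=> j i ji; exact: (@cylinders_measurable_fun _ _ _ _ _
      (join_families a eta) (all_but_signs_from k n) (inl (j, i)) ji).
  - apply: filterS good => w gw n.
    exact: (noise_le _ _ gamma_gt0 eps01 f_lip L'0 B0 HB).
apply: filterS2 good noise_cvg => w gw cw.
pose y n := base_point tau q X n w.
pose G v i := partial i f v.
pose b n i := central_quotient tau q f eps X i n w - G (y n) i.
pose M n i := \sum_(0 <= j < n) a i j w * noise_k i j w.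
pose bound n := D * (2 * eps n + r n * (L' * B + C)).
have bound0 : bound n @[n --> \oo] --> 0.
  rewrite -(mulr0 D); apply: cvgMr; rewrite -[X in _ --> X]addr0; apply: cvgD.
    by rewrite -(mulr0 2); apply: cvgMr.
  by rewrite -(mul0r (L' * B + C)); apply: cvgMl.
have ycvg : y n @[n --> \oo] --> xstar.
  apply: (@noisy_ascent_cvg R K xstar G `|L| _ _ gamma _ _ _ D y b M) => //.
  - by move=> v i; exact: pf_bounded.
  - move=> rr rr0.
    have [U nU fU] := f_strict.
    have [cc cc0 gap] := concave_gap f_concave rr0 f_diff
      (strict_maximizer f_concave xstar_max nU fU).
    exists cc => // v rv; rewrite (le_trans (gap v rv))//.
    by rewrite (le_trans (concave_gradient f_concave _ (f_diff v)))// derive_partial.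
  - by move=> n; exact: ltW.
  - by move=> u v i; exact: pf_lip.
  - move=> i; apply/norm_cvg0P.
    apply: (@squeeze_cvgr _ _ _ _ (fun=> 0) bound); [|exact: cvg_cst|exact: bound0].
    apply: nearW => n; rewrite normr_ge0 /=.
    exact: (central_quotient_bias tau_ge2 q_lt X_traj gamma_gt0 eps01 f_lip L'0
      C0 B0 HB f_diff D0 pf_lip).
  - move=> n i; rewrite /y (base_pointS tau_ge2 X_traj).
    rewrite (gradient_decomposition X_traj eps01); last by case: gw.
    by rewrite /M big_nat_recr//= /b /G /noise_k /y; ring.
have xE n : x n%:Z w = X n.+1 w by rewrite /X; congr (x _ w); lia.
have dist0 : (eps n + r n * (L' * B + C)) @[n --> \oo] --> 0.
  rewrite -[X in _ --> X]addr0; apply: cvgD => //.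
  by rewrite -(mul0r (L' * B + C)); apply: cvgMl.
have slot_to_oo := divn_cvg tau_ge2.
have y_slot := cvg_comp _ _ slot_to_oo ycvg.
have d_slot := cvg_comp _ _ slot_to_oo dist0.
(* Iterate n is the state at the shifted time n + 1, which lies in slot n / tau. *)
rewrite (_ : (fun n : nat => x n%:Z w) =
    fun n => (X n.+1 w - y (n %/ tau)%N) + y (n %/ tau)%N);
  last by apply/funext => n; rewrite xE subrK.
rewrite -[X in _ --> X]add0r; apply: cvgD; last exact: y_slot.
apply/norm_cvg0P; apply: (@squeeze_cvgr _ _ _ _ (fun=> 0) _ _ _ _ _ d_slot);
  last exact: cvg_cst.
apply: nearW => n; rewrite normr_ge0 /=.
apply: (slot_dist tau_ge2 q_lt X_traj gamma_gt0 eps01 f_lip L'0 C0 B0 HB) => //.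
have := divn_eq n tau; have := @ltn_pmod n tau; rewrite mulSn; lia.
Qed.
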